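(* Suppose that $\tau_i=N(f_i)$ for $i=1,\dots,n$, where $N$ is a Poisson random measure on $\mathscr V$ with intensity $\nu$. Then the likelihood $$\mathscr L(\mathbf X|\mu,\beta,\theta)=\int_{\mathbb R_+^n}\Big[\prod_{i=1}^n\phi(X_i|\mu\Delta+\beta w_i^{-1},w_i^{-1})\Big]\,\mathbb E\Big[\prod_{i=1}^n e^{-w_i\tau_i}\tau_i\Big]\prod_{i=1}^n dw_i$$ can be expressed as $$\mathscr L(\mathbf X|\mu,\beta,\theta)=\int_{\mathbb R_+^n}\mathscr B(\mathbf w)\,e^{-\Lambda(\Omega_n)}\prod_{i=1}^n\phi(X_i|\mu\Delta+\beta w_i^{-1},w_i^{-1})\,dw_i,$$ where $$\mathscr B(\mathbf w)=\int_{\mathscr V^n}\prod_{i=1}^n f_i(v_i)\,\mathscr M(d\mathbf v|\nu_{\Omega_n})=\sum_{\mathbf p}\prod_{j=1}^{n(\mathbf p)}\int_{\mathscr V}\Big[\prod_{i\in C_j}f_i(v)\Big]\nu_{\Omega_n}(dv),$$ and $\sum_{\mathbf p}$ denotes the sum over all partitions $\mathbf p=\{C_1,\dots,C_{n(\mathbf p)}\}$ of the integers $\{1,\dots,n\}$.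
   Context: Let $\mathscr V$ be a Polish space, $\nu$ a boundedly finite measure on $\mathscr V$, and $N$ a Poisson random measure on $\mathscr V$ with mean intensity $\mathbb E[N(dv)]=\nu(dv)$. Write $N(f)=\int f\,dN$ and $\Lambda(f)=\int_{\mathscr V}(1-e^{-f(v)})\,\nu(dv)$, so that $\mathbb E[e^{-N(f)}]=e^{-\Lambda(f)}$ for $f\ge 0$. Let $n\ge1$ and let $f_1,\dots,f_n:\mathscr V\to[0,\infty)$ be measurable with $\Lambda(\sum_{i=1}^n w_if_i)<\infty$ for all non-negative $w_1,\dots,w_n$. For $\mathbf w=(w_1,\dots,w_n)$ put $\Omega_n(v)=\sum_{i=1}^n w_if_i(v)$ and $\nu_{\Omega_n}(dv)=e^{-\Omega_n(v)}\nu(dv)$. $\phi(x|m,s^2)$ is the Normal density with mean $m$ and variance $s^2$. $\Delta>0$, $\mu,\beta\in\mathbb R$ are fixed, $\theta$ denotes whatever parameters the law of $N$ depends on, and $\mathbf X=(X_1,\dots,X_n)\in\mathbb R^n$ are the observations. (The likelihood is that of the model $X_i\overset{d}{=}\mu\Delta+(\tau_i/Z_i)\beta+(\tau_i/Z_i)^{1/2}\epsilon_i$, conditionally independent given $\tau_1,\dots,\tau_n$, with $Z_i$ i.i.d. exponential of mean 1 and $\epsilon_i$ i.i.d. standard Normal, independent of the $Z_i$, after the change of variable $w_i=z_i/\tau_i$.) $\mathscr M(d\mathbf v|\nu_{\Omega_n})$ is the $n$-th moment measure of a Poisson random measure with intensity $\nu_{\Omega_n}$: for a measure $\rho$, $\mathscr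 M(d\mathbf v|\rho)=\mathbb E[\prod_{i=1}^n N'(dv_i)]$ on $\mathscr V^n$, where $N'$ is Poisson with intensity $\rho$; equivalently $\mathscr M(d\mathbf v|\rho)=\rho(dv_1)\prod_{i=2}^n[\rho(dv_i)+\sum_{j=1}^{n(\mathbf p_{i-1})}\delta_{v^*_j}(dv_i)]$, where $v_1^*,\dots,v^*_{n(\mathbf p_{i-1})}$ are the distinct points among $v_1,\dots,v_{i-1}$ and $\mathbf p_{i-1}$ is the induced partition of $\{1,\dots,i-1\}$ (a new draw from $\rho$ opens a new cell, a draw from $\delta_{v_j^*}$ joins cell $j$). *)

(* Defs.v *)
From HB Require Import structures.
From mathcomp Require Import all_boot all_order all_algebra.
From mathcomp Require Import all_classical all_reals all_analysis.
From mathcomp Require Import measurable_realfun.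

Set Implicit Arguments.
Unset Strict Implicit.
Unset Printing Implicit Defensive.

Import Order.TTheory GRing.Theory Num.Theory.
Import numFieldNormedType.Exports.

Local Open Scope classical_set_scope.
Local Open Scope ring_scope.

(* Bounded finiteness of a measure depends on a choice of metric, so a Polish
   space is taken with a complete metric that induces its topology. *)
#[short(type="completeMetricType")]
HB.structure Definition CompleteMetric (R : numDomainType) :=
  {V of Complete V & Metric R V}.

Definition separable (V : topologicalType) : Prop :=
  exists2 D : set V, countable D & dense D.

Notation borel V := (g_sigma_algebraType (@open V)).

(* Iterated-integral form of the [n]-fold product of [mu], as for the library's
   [product_measure1]; it is a measure when [mu] is sigma-finite. *)
Fixpoint power_measure (R : realType) d (T : measurableType d)
    (mu : set T -> \bar R) (n : nat) : set (n.-tuple T) -> \bar R :=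
  match n with
  | 0%N => fun A => \d_[tuple] A
  | m.+1 => fun A =>
      (\int[mu]_x power_measure mu [set t : m.-tuple T | A [tuple of x :: t]])%E
  end.
Arguments power_measure {R d T} mu n A.

Section point_processes.
Context (R : realType).
Local Open Scope ereal_scope.

Definition boundedly_finite (V : completeMetricType R)
    (rho : set V -> \bar R) : Prop :=
  forall A : set (borel V), measurable A ->
    (exists (x : V) (r : R), A `<=` ball x r) -> rho A < +oo.

Definition mutually_independent d (T : measurableType d) (P : probability T R)
    (k : nat) (X : 'I_k -> T -> \bar R) : Prop :=
  forall B : 'I_k -> set (\bar R), (forall i, measurable (B i)) ->
    P [set x | forall i, B i (X i x)] = \prod_(i < k) P [set x | B i (X i x)].

(* Not the library's [poisson_pmf], which is 1 at every [k] when the rate is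
   not positive; here rate 0 gives the point mass at 0. *)
Definition poisson_mass (lambda : R) (k : nat) : R :=
  (lambda ^+ k / k`!%:R * expR (- lambda))%R.

(* No clause is needed for [rho A = +oo]: a boundedly finite [rho] on a
   separable space is sigma-finite, so then [N A = +oo] almost surely. *)
Record poisson_random_measure d (T : measurableType d) (P : probability T R)
    (V : completeMetricType R) (rho : set V -> \bar R)
    (N : R.-ker T ~> borel V) : Prop := PoissonRandomMeasure {
  prm_boundedly_finite : forall x, boundedly_finite (N x) ;
  prm_poisson : forall A : set (borel V), measurable A -> rho A < +oo ->
    forall k : nat,
      P [set x | N x A = k%:R%:E] = (poisson_mass (fine (rho A)) k)%:E ;
  prm_independent : forall (k : nat) (A : 'I_k -> set (borel V)),
    (forall i, measurable (A i)) -> trivIset setT A ->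
    mutually_independent P (fun i x => N x (A i)) }.

Definition random_integral d (T : measurableType d) (V : completeMetricType R)
    (N : R.-ker T ~> borel V) (f : V -> R) (x : T) : \bar R :=
  \int[N x]_v (f v)%:E.

(* [M = E[N(dv_1) ... N(dv_n)]] for a Poisson [N] of intensity [rho]; the law of
   [N], hence [M], depends only on [rho]. *)
Definition poisson_moment_measure (V : completeMetricType R)
    (rho : set V -> \bar R) (n : nat)
    (M : {measure set (n.-tuple (borel V)) -> \bar R}) : Prop :=
  exists d (T : measurableType d) (P : probability T R)
      (N : R.-ker T ~> borel V),
    poisson_random_measure P rho N /\
    forall A : set (n.-tuple (borel V)), measurable A ->
      M A = \int[P]_x power_measure (N x) n A.

End point_processes.

Section likelihood.
Context (R : realType) (V : completeMetricType R).
Context (nu : {measure set (borel V) -> \bar R}) (n : nat) (f : 'I_n -> V -> R).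
Local Open Scope ereal_scope.

Definition Lambda (g : V -> R) : \bar R :=
  \int[nu]_v (1 - expR (- g v))%R%:E.

Definition Omega (w : n.-tuple R) (v : V) : R :=
  (\sum_(i < n) tnth w i * f i v)%R.

(* A measure as soon as the [f i] are measurable. *)
Definition tilted (w : n.-tuple R) (A : set (borel V)) : \bar R :=
  \int[nu]_(v in A) (expR (- Omega w v))%:E.

Definition partition_sum (w : n.-tuple R) : \bar R :=
  \sum_(p : {set {set 'I_n}} | finset.partition p [set: 'I_n]%SET)
    \prod_(C in p) \int[tilted w]_v (\prod_(i in C) f i v)%R%:E.

Definition moment_integral
    (M : {measure set (n.-tuple (borel V)) -> \bar R}) : \bar R :=
  \int[M]_v (\prod_(i < n) f i (tnth v i))%R%:E.

(* The library's [normal_pdf] takes the standard deviation. *)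
Definition normal_density (m s2 x : R) : R := normal_pdf m (Num.sqrt s2) x.

Definition observation_density (Delta mu beta : R) (X w : n.-tuple R) : R :=
  (\prod_(i < n) normal_density (mu * Delta + beta * (tnth w i)^-1)
     (tnth w i)^-1 (tnth X i))%R.

(* Integral over [(0, +oo)^n] for the [n]-dimensional Lebesgue measure; the
   coordinates are positive because [w_i^-1] is a variance. *)
Definition integral_Rplus (F : n.-tuple R -> \bar R) : \bar R :=
  \int[power_measure (@lebesgue_measure R) n]_(w in
     [set w | forall i, (0 < tnth w i)%R]) F w.

Definition likelihood d (T : measurableType d) (P : probability T R)
    (N : R.-ker T ~> borel V) (Delta mu beta : R) (X : n.-tuple R) : \bar R :=
  integral_Rplus (fun w => (observation_density Delta mu beta X w)%:E *
    \int[P]_x \prod_(i < n)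
      (expeR (- ((tnth w i)%:E * random_integral N (f i) x)) *
       random_integral N (f i) x)).

End likelihood.

(* Main.v *)
Require Import Defs.
From HB Require Import structures.
From mathcomp Require Import all_boot all_order all_algebra.
From mathcomp Require Import all_classical all_reals all_analysis.
From mathcomp Require Import measurable_realfun.
From mathcomp Require Import ring.

(* For a Poisson random measure N of intensity rho and nonnegative g, f_i,
     E[e^{-N(g)} prod_i N(f_i)] =
       e^{-Lambda(g)} sum_p prod_{C in p} int (prod_{i in C} f_i) e^{-g} drho
   holds in [0, +oo]. When g and the f_i are step functions over finitely many
   disjoint sets of finite intensity, Mecke's equation for the vector of Poisson
   counts gives the left-hand side the recursion obtained on the right by sorting
   the partitions by the block of a fixed index. Dominated convergence then
   extends the identity to all g, and monotone convergence to all f_i.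
   With g = Omega_n and rho = nu it identifies the integrand of the likelihood at
   each w; with g = 0 and rho the tilted intensity it evaluates the integral
   against the moment measure, whose value on rectangles is E[prod_i N(A_i)]. *)

Set Implicit Arguments.
Unset Strict Implicit.
Unset Printing Implicit Defensive.

Import Order.TTheory GRing.Theory Num.Theory.
Import numFieldNormedType.Exports.

Local Open Scope classical_set_scope.
Local Open Scope ring_scope.
Local Open Scope ereal_scope.

(** * Partition sums and Poisson vectors *)

(** The exponential stays inside the moment because of what Mecke's equation does: it adds a point
    at v, which replaces N(f_i) by N(f_i) + f_i(v) and multiplies e^{-N(g)} by e^{-g(v)}. The
    indices whose factor takes f_i(v), together with the fixed index, form its block, e^{-g(v)} is
    the tilt of rho, and the other factors form the same kind of moment with fewer indices. The
    recursion ends at E[e^{-N(g)}], the source of e^{-Lambda(g)}. The obstacle is infinite values: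
    Lambda(g), N(g) and the moments may all be infinite, and both sides decrease in g. Supports in
    balls keep the moments finite while g varies; the f_i are released last, when both sides
    increase. The random measure that realizes the moment measure lives on a space of its own and
    has the tilted intensity, so the identity is proved for an arbitrary Poisson random measure. *)

Section partitions.
Local Open Scope set_scope.
Context (I : finType).

(* Sorts the partitions of [D] by the block [C] containing [i0]. *)
Lemma partition_recursion (R : comPzSemiRingType) (m : {set I} -> R)
    (D : {set I}) (i0 : I) : i0 \in D ->
  (\sum_(p : {set {set I}} | finset.partition p D) \prod_(C in p) m C =
   \sum_(C : {set I} | (i0 \in C) && (C \subset D)) m C *
     \sum_(p : {set {set I}} | finset.partition p (D :\: C)) \prod_(B in p) m B)%R.
Proof.
move=> iD.
rewrite (partition_big (fun p : {set {set I}} => finset.pblock p i0)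
  (fun C : {set I} => (i0 \in C) && (C \subset D))); last first.
  move=> p pD; have ip : i0 \in finset.cover p by rewrite (cover_partition pD).
  rewrite finset.mem_pblock ip /=.
  exact: (partitionS pD (finset.pblock_mem ip)).
apply: eq_bigr => C /andP[iC CD]; rewrite big_distrr /=.
have C0 : C != finset.set0 by apply/finset.set0Pn; exists i0.
have blockC p : finset.partition p D -> finset.pblock p i0 = C -> C \in p.
  move=> pD <-; apply: finset.pblock_mem; by rewrite (cover_partition pD).
have notin q : finset.partition q (D :\: C) -> C \notin q.
  move=> qD; apply/negP => Cq.
  have /fintype.subsetP/(_ i0 iC) := partitionS qD Cq.
  by rewrite finset.inE iC.
(* Removing [C] maps the partitions of [D] in which [C] is the block of [i0] onto those of
   [D :\: C]; adding [C] inverts it, since [i0] keeps [C] out of every partition of [D :\: C]. *)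
rewrite (reindex_onto (fun q : {set {set I}} => C |: q)
  (fun p : {set {set I}} => p :\ C)) /=; last first.
  move=> p /andP[pD /eqP pC]; rewrite finset.setD1K//; exact: blockC.
apply: eq_big => [q|q qD].
  apply/idP/idP => [/andP[/andP[pD /eqP pC] /eqP <-]|qD].
    by apply: partitionD1 => //; rewrite finset.setU11.
  have pD : finset.partition (C |: q) D.
    rewrite -[D](finset.setID D C) (finset.setIidPr CD).
    apply: partitionU1 => //.
    by rewrite finset.disjoints_subset finset.setCD finset.subsetUr.
  rewrite pD finset.setU1K ?notin// eqxx andbT /=; apply/eqP.
  apply: finset.def_pblock; [exact: partition_trivIset pD|exact: finset.setU11|by []].
have {}qD : finset.partition q (D :\: C).
  move: qD => /andP[/andP[pD /eqP pC] /eqP <-].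
  by apply: partitionD1 => //; rewrite finset.setU11.
by rewrite big_setU1 ?notin.
Qed.

End partitions.

Section countable_partition.
Context (R : realType) d (T : measurableType d)
  (mu : {measure set T -> \bar R}).

(* [pickle_inv] enumerates the countable type [C]; codes of no element of [C]
   contribute the summand 0. *)
Lemma ge0_integral_countable_partition (C : countType) (E : C -> set T)
    (H : T -> \bar R) :
  (forall c, measurable (E c)) -> trivIset setT E ->
  mu (~` \bigcup_c E c) = 0 ->
  measurable_fun setT H -> (forall x, 0 <= H x) ->
  \int[mu]_x H x = \sum_(0 <= j <oo)
    oapp (fun c => \int[mu]_(x in E c) H x) 0 (pickle_inv j).
Proof.
move=> mE tE E1 mH H0.
pose F j := oapp E set0 (pickle_inv j).
have UF : \bigcup_c E c = \bigcup_j F j.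
  apply/seteqP; split => x [c _ xc].
    by exists (pickle c) => //; rewrite /F pickleK_inv.
  by move: xc; rewrite /F; case: (pickle_inv c) => // c' ?; exists c'.
have mF j : measurable (F j).
  by rewrite /F; case: (pickle_inv j) => [c|] /=; [exact: mE|exact: measurable0].
have mUF : measurable (\bigcup_j F j) by exact: bigcup_measurable.
have tF : trivIset setT F.
  move=> i j _ _; rewrite /F.
  have := @pickle_invK C i; have := @pickle_invK C j.
  case: (pickle_inv i) => [a|] /=; last by move=> _ _ [x []].
  case: (pickle_inv j) => [b|] /=; last by move=> _ _ [x []].
  by move=> <- <- ab; rewrite (tE a b I I ab).
rewrite (ge0_negligible_integral (measurableC mUF) measurableT mH) //; [|by rewrite -UF].
rewrite setTD setCK (ge0_integral_bigcup _ mF)//; last exact: measurable_funTS.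
apply: eq_eseriesr => j _; rewrite /F.
by case: (pickle_inv j) => [c|] //=; rewrite integral_set0.
Qed.

Lemma ge0_integral_countably_valued (C : countType) (E : C -> set T)
    (H : T -> \bar R) (h : C -> \bar R) :
  (forall c, measurable (E c)) -> trivIset setT E ->
  mu (~` \bigcup_c E c) = 0 ->
  measurable_fun setT H -> (forall x, 0 <= H x) ->
  (forall c x, E c x -> H x = h c) ->
  \int[mu]_x H x = \sum_(0 <= j <oo)
    oapp (fun c => h c * mu (E c)) 0 (pickle_inv j).
Proof.
move=> mE tE E1 mH H0 Hh.
rewrite (ge0_integral_countable_partition mE)//.
apply: eq_eseriesr => j _; case: (pickle_inv j) => [c|] //=.
rewrite (@eq_integral _ _ _ _ _ (cst (h c))) ?integral_cst//.
by move=> x; rewrite inE => /Hh.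
Qed.

End countable_partition.

Section poisson_sum.
Context (R : realType).

Lemma poisson_mass_ge0 (l : R) k : (0 <= l -> 0 <= poisson_mass l k)%R.
Proof.
by move=> l0; rewrite /poisson_mass !mulr_ge0 ?expR_ge0 ?exprn_ge0 ?invr_ge0.
Qed.

Lemma poisson_massS (l : R) k :
  (k.+1%:R * poisson_mass l k.+1 = l * poisson_mass l k)%R.
Proof.
rewrite /poisson_mass factS natrM exprS invfM; field.
by rewrite -[X in (X + _)%R]/(1%:R)%R -natrD !pnatr_eq0 -lt0n fact_gt0.
Qed.

(** Up to the factor [expR (- l)], the terms are those of the exponential series at
    [l * expR (- b)]. The sign of [b] is free, so [b = 0] gives total mass 1. *)
Lemma poisson_laplace (l b : R) : (0 <= l)%R ->
  \sum_(0 <= k <oo) (expR (- (b * k%:R)) * poisson_mass l k)%:E =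
  (expR (- (l * (1 - expR (- b)))))%:E.
Proof.
move=> l0.
rewrite (_ : (expR (- (l * (1 - expR (- b)))) =
  expR (- l) * expR (l * expR (- b)))%R); last by rewrite -expRD; congr expR; ring.
have expRE (x : R) : (expR x)%:E = limn (EFin \o series (exp_coeff x)).
  by rewrite (EFin_lim (is_cvg_series_exp_coeff _)).
rewrite EFinM (expRE (l * _)%R).
transitivity (\sum_(0 <= k <oo) ((expR (- l))%:E * (exp_coeff (l * expR (- b)) k)%:E)).
  apply: eq_eseriesr => k _; rewrite -EFinM; congr EFin.
  rewrite /poisson_mass /exp_coeff /= exprMn -expRM_natr mulNr; ring.
rewrite nneseriesZl; last first.
  by move=> k _; rewrite lee_fin exp_coeff_ge0// mulr_ge0 ?expR_ge0.
congr (_ * limn _); apply/funext => n /=.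
by rewrite /series /= sumEFin.
Qed.

Lemma poisson_mass_sum (l : R) : (0 <= l)%R ->
  \sum_(0 <= k <oo) (poisson_mass l k)%:E = 1.
Proof.
move=> l0; have := poisson_laplace 0 l0.
rewrite oppr0 expR0 subrr mulr0 oppr0 expR0 => <-.
by apply: eq_eseriesr => k _; rewrite mul0r oppr0 expR0 mul1r.
Qed.

End poisson_sum.

Lemma measurable_forall d (T : measurableType d) (Y : finType) (E : Y -> set T) :
  (forall y, measurable (E y)) -> measurable [set x | forall y, E y x].
Proof.
move=> mE; rewrite (_ : [set x | _] = \bigcap_(y in [set: Y]) E y).
  by apply: fin_bigcap_measurable => //; exact: finite_finset.
by apply/seteqP; split => x /= xE y; [move=> _|]; exact: xE.
Qed.

Lemma emeasurable_prod d (T : measurableType d) (R : realType) (D : set T)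
    (I : Type) (s : seq I) (h : I -> T -> \bar R) :
  (forall i, measurable_fun D (h i)) ->
  measurable_fun D (fun x => \prod_(i <- s) h i x).
Proof.
move=> mh; elim: s => [|i s IHs].
  by rewrite (_ : (fun _ => _) = cst 1)//; apply/funext => x; rewrite big_nil.
rewrite (_ : (fun _ => _) = h i \* (fun x => \prod_(i <- s) h i x)).
  exact: emeasurable_funM.
by apply/funext => x; rewrite big_cons.
Qed.

Lemma measurable_expeR (R : realType) : measurable_fun setT (@expeR R).
Proof.
rewrite (_ : @expeR R = fun x => if x == +oo then +oo else
    if x == -oo then 0 else (expR (fine x))%:E); last by apply/funext; case.
apply: measurable_fun_ifT => //.
  apply: (measurable_fun_bool true); rewrite setTI.
  rewrite (_ : _ @^-1` _ = [set +oo]); first exact: emeasurable_set1.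
  by apply/seteqP; split => x /=; [move/eqP|move=> ->; rewrite eqxx].
apply: measurable_fun_ifT => //.
  apply: (measurable_fun_bool true); rewrite setTI.
  rewrite (_ : _ @^-1` _ = [set -oo]); first exact: emeasurable_set1.
  by apply/seteqP; split => x /=; [move/eqP|move=> ->; rewrite eqxx].
apply/measurable_EFinP; apply: measurableT_comp; first exact: measurable_expR.
exact: fine_measurable.
Qed.

Section poisson_vector.
Context (R : realType) d (T : measurableType d) (P : probability T R).
Context (Y : finType) (X : Y -> T -> \bar R) (lam : Y -> R).
Context (mX : forall y, measurable_fun setT (X y)).
Context (lam0 : forall y, (0 <= lam y)%R).
Context (pX : forall y (k : nat),
  P [set x | X y x = k%:R%:E] = (poisson_mass (lam y) k)%:E).
Context (indX : forall B : Y -> set (\bar R), (forall y, measurable (B y)) ->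
  P [set x | forall y, B y (X y x)] = \prod_(y : Y) P [set x | B y (X y x)]).

Let mXB y (B : set (\bar R)) : measurable B -> measurable [set x | B (X y x)].
Proof. by move=> mB; rewrite -[X in measurable X]setTI; exact: mX. Qed.

(** Finite functions into [nat] form a countable type, so these events fit the countable
    decompositions of an integral. *)
Definition count_event (k : {ffun Y -> nat}) : set T :=
  [set x | forall y, X y x = (k y)%:R%:E].

Lemma measurable_count_event k : measurable (count_event k).
Proof.
apply: measurable_forall => y.
exact: (mXB _ (emeasurable_set1 ((k y)%:R%:E : \bar R))). 
Qed.

Lemma trivIset_count_event : trivIset setT count_event.
Proof.
move=> k l _ _ [x [xk xl]]; apply/ffunP => y.
by have := xk y; rewrite xl => -[] /eqP; rewrite eqr_nat => /eqP.
Qed.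

Lemma prob_count_event k :
  P (count_event k) = (\prod_y poisson_mass (lam y) (k y))%:E.
Proof.
rewrite -prodEFin (indX (B := fun y => [set (k y)%:R%:E])).
  by apply: eq_bigr => y _; exact: pX.
by move=> y; exact: emeasurable_set1.
Qed.

(** The Poisson masses sum to 1, which leaves probability 0 for all other values of [X y], +oo
    included. *)
Lemma ae_natural y : P (~` \bigcup_k [set x | X y x = k%:R%:E]) = 0.
Proof.
have mE (k : nat) : measurable [set x | X y x = k%:R%:E].
  exact: (mXB _ (emeasurable_set1 (k%:R%:E : \bar R))).
rewrite probability_setC; last exact: bigcup_measurable.
rewrite measure_semi_bigcup//.
- rewrite (eq_eseriesr (g := fun k => (poisson_mass (lam y) k)%:E)).
    by rewrite poisson_mass_sum// subee.
  by move=> k _; exact: pX.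
- move=> i j _ _ [x /= [-> []]] /eqP; by rewrite eqr_nat => /eqP.
- exact: bigcup_measurable.
Qed.

Lemma ae_count_event : P (~` \bigcup_k count_event k) = 0.
Proof.
apply/eqP; rewrite eq_le measure_ge0 andbT.
pose F y := ~` \bigcup_k [set x | X y x = k%:R%:E].
have mF y : measurable (F y).
  apply/measurableC/bigcup_measurable => k _.
  exact: (mXB _ (emeasurable_set1 (k%:R%:E : \bar R))).
have : P (~` \bigcup_k count_event k) <= (\sum_(y \in [set: Y]) P (F y))%R.
  apply: content_sub_fsum => //; first exact: finite_finset.
    apply/measurableC/countable_bigcupT_measurable; first exact: countableP.
    exact: measurable_count_event.
  move=> x /= nx; apply: contrapT => nF; apply: nx.
  have H y : exists k : nat, X y x = k%:R%:E.
    apply: contrapT => nk; apply: nF; exists y => //= -[k _ xk]; apply: nk; by exists k.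
  exists [ffun y => projT1 (cid (H y))] => // y; rewrite ffunE.
  exact: (projT2 (cid (H y))).
by rewrite fsbig1 => [|y _]//; exact: ae_natural.
Qed.

(* The Mecke equation [E[X_y F(X)] = lam_y E[F(X + e_y)]]. Both expectations are
   sums over the same vectors [k], and they agree term by term because
   [(j + 1) p(j + 1) = lam p(j)] for a Poisson mass function [p]. *)
Lemma poisson_mecke (y : Y) (F : {ffun Y -> nat} -> R) (H1 H2 : T -> \bar R) :
  measurable_fun setT H1 -> (forall x, 0 <= H1 x) ->
  measurable_fun setT H2 -> (forall x, 0 <= H2 x) ->
  (forall k, (0 <= F k)%R) ->
  (forall k x, count_event k x -> H1 x = ((k y)%:R * F k)%:E) ->
  (forall k x, count_event k x ->
    H2 x = (F [ffun z => (k z + (z == y))%N])%:E) ->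
  \int[P]_x H1 x = (lam y)%:E * \int[P]_x H2 x.
Proof.
move=> mH1 H10 mH2 H20 F0 H1E H2E.
pose pre (k : {ffun Y -> nat}) := [ffun z => (k z - (z == y))%N].
pose suc (k : {ffun Y -> nat}) := [ffun z => (k z + (z == y))%N].
have sucK : cancel suc pre by move=> k; apply/ffunP => z; rewrite !ffunE addnK.
have preK (k : {ffun Y -> nat}) : (0 < k y)%N -> suc (pre k) = k.
  move=> ky; apply/ffunP => z; rewrite !ffunE subnK//.
  by case: eqP => [->|].
(* To match the two sums, that of [H2] is indexed by the shifted vector [k = suc (pre k)]: [H2]
   equals [F k] on the event of [pre k]. A vector with [k y = 0] is not a shift and gets the empty
   event; in the sum of [H1] its term vanishes through the factor [k y]. *)
pose E' (k : {ffun Y -> nat}) := if (0 < k y)%N then count_event (pre k) else set0.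
rewrite (ge0_integral_countably_valued measurable_count_event
  trivIset_count_event ae_count_event mH1 H10 H1E).
rewrite (@ge0_integral_countably_valued _ _ _ _ _ E' _ (EFin \o F))//; first last.
- move=> k x; rewrite /E'; case: ifPn => // k0 xk.
  by rewrite (H2E _ _ xk) /= -[X in F X]/(suc (pre k)) preK.
- have -> : \bigcup_c E' c = \bigcup_c count_event c; last exact: ae_count_event.
  apply/seteqP; split => x [k _].
    by rewrite /E'; case: ifPn => // _ ?; exists (pre k).
  move=> xk; exists (suc k) => //.
  by rewrite /E' sucK ffunE eqxx addn1.
- move=> k l _ _ [x []]; rewrite /E'; case: ifPn => // k0 xk; case: ifPn => // l0 xl.
  rewrite -(preK _ k0) -(preK _ l0); congr suc.
  by apply: trivIset_count_event => //; exists x.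
- move=> k; rewrite /E'; case: ifPn => // _; exact: measurable_count_event.
rewrite -nneseriesZl; last first.
  by move=> j _; case: (pickle_inv j) => //= k; rewrite mule_ge0// lee_fin.
apply: eq_eseriesr => j _; case: (pickle_inv j) => [k|] /=; last by rewrite mule0.
rewrite /E'; case: ifPn => [k0|]; last first.
  by rewrite -eqn0Ngt => /eqP ->; rewrite measure0 mul0r mul0e !mule0.
rewrite !prob_count_event -!EFinM; congr EFin.
rewrite (bigD1 y)//= [in RHS](bigD1 y)//= !ffunE eqxx.
rewrite [in RHS](eq_bigr (fun z => poisson_mass (lam z) (k z))); last first.
  by move=> z zy; rewrite ffunE (negbTE zy) subn0.
case: (k y) k0 => // m _; rewrite subn1 /=.
set r := (\prod_(_ | _) _)%R.
transitivity (F k * (m.+1%:R * poisson_mass (lam y) m.+1) * r)%R; first by ring.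
by rewrite poisson_massS; ring.
Qed.

Section laplace.
Context (b : Y -> R).

(* The coordinates in [s] carry their exponential, the others an event; the
   induction on [s] converts one coordinate at a time. *)
Let Z (s : seq Y) (B : Y -> set (\bar R)) (x : T) : \bar R :=
  \prod_(y <- s) expeR (- ((b y)%:E * X y x)) *
  (\1_[set x | forall y, y \notin s -> B y (X y x)] x)%:E.

Let measurable_event (s : seq Y) (B : Y -> set (\bar R)) : (forall y, measurable (B y)) ->
  measurable [set x | forall y, y \notin s -> B y (X y x)].
Proof.
move=> mB.
apply: (measurable_forall (E := fun y => [set x | y \notin s -> B y (X y x)])) => y.
case: (boolP (y \in s)) => ys.
  by rewrite (_ : [set x | _] = setT)//; apply/seteqP; split.
rewrite (_ : [set x | _] = [set x | B y (X y x)]); first exact: mXB.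
by apply/seteqP; split => x /=; [exact|].
Qed.

Let Z_ge0 s B x : 0 <= Z s B x.
Proof.
by rewrite mule_ge0 ?lee_fin// prode_ge0// => y _; exact: expeR_ge0.
Qed.

Let measurable_Z s B : (forall y, measurable (B y)) -> measurable_fun setT (Z s B).
Proof.
move=> mB; apply: emeasurable_funM.
  apply: emeasurable_prod => y; apply: measurableT_comp; first exact: measurable_expeR.
  by apply: measurableT_comp => //; exact: measurable_funeM.
by apply/measurable_EFinP/measurable_indic/measurable_event.
Qed.

Let Z_cons y (s : seq Y) B (j : nat) x : y \notin s -> X y x = j%:R%:E ->
  Z (y :: s) B x = (expR (- (b y * j%:R)))%:E *
    Z s (fun z => if z == y then [set j%:R%:E] else B z) x.
Proof.
move=> ys xj; rewrite /Z big_cons xj /= -muleA; congr (_ * (_ * _)).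
rewrite !indicE; congr (_%:R%:E); congr nat_of_bool.
apply/idP/idP; rewrite !inE /= => H z zs.
  case: eqP => [->//|/eqP zy]; apply: H.
  by rewrite inE negb_or zy.
move: zs; rewrite inE negb_or => /andP[/negbTE zy zs].
by have := H z zs; rewrite zy.
Qed.

Let Z_cons0 y (s : seq Y) B (j : nat) x : y \notin s -> X y x <> j%:R%:E ->
  Z s (fun z => if z == y then [set j%:R%:E] else B z) x = 0.
Proof.
move=> ys xj; rewrite /Z indicE memNset ?mule0//= => /(_ y ys).
by rewrite eqxx.
Qed.

(** [B] has to be arbitrary in the induction: to convert [y], the integral is split along [X y = j]
    and the hypothesis is applied with [B y] replaced by the singleton of [j]. Summing over [j]
    gives the Laplace transform of one count. Independence enters at [s = [::]], as a statement
    about events. *)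
Lemma poisson_vector_laplace_partial (s : seq Y) : uniq s ->
  forall B : Y -> set (\bar R), (forall y, measurable (B y)) ->
  \int[P]_x Z s B x =
    (\prod_(y <- s) expR (- (lam y * (1 - expR (- b y)))) *
     \prod_(y | y \notin s) fine (P [set x | B y (X y x)]))%:E.
Proof.
elim: s => [_|y s IHs /= /andP[ys us]] B mB.
  rewrite big_nil mul1r -prodEFin.
  rewrite (eq_integral (fun x => (\1_[set x | forall y, B y (X y x)] x)%:E)).
    rewrite integral_indic//; last first.
      by apply: (measurable_forall (E := fun y => [set x | B y (X y x)])) => y; exact: mXB.
    rewrite setIT (eq_bigl xpredT)//.
    transitivity (\prod_y P [set x | B y (X y x)]); first exact: indX.
    apply: eq_bigr => y _.
    by rewrite fineK// fin_num_measure//; exact: mXB.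
  move=> x _; rewrite /Z big_nil mul1e; congr (\1_ _ _)%:E.
  by apply/seteqP; split => z /= H w => [|_]; exact: H.
pose E (j : nat) := [set x | X y x = j%:R%:E].
have mE j : measurable (E j) by exact: (mXB _ (emeasurable_set1 (j%:R%:E : \bar R))).
have tE : trivIset setT E.
  by move=> i j _ _ [x []]; rewrite /E /= => -> [] /eqP; rewrite eqr_nat => /eqP.
rewrite (ge0_integral_countable_partition mE tE (ae_natural y))//; last exact: measurable_Z.
pose c := (\prod_(y <- s) expR (- (lam y * (1 - expR (- b y)))) *
     \prod_(z | z \notin y :: s) fine (P [set x | B z (X z x)]))%R.
have c0 : (0 <= c)%R.
  apply: mulr_ge0; apply: prodr_ge0 => z _; [exact: expR_ge0|exact: fine_ge0].
rewrite (eq_eseriesr (g := fun j => c%:E *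
    (expR (- (b y * j%:R)) * poisson_mass (lam y) j)%:E)).
  rewrite nneseriesZl; last first.
    by move=> j _; rewrite lee_fin mulr_ge0 ?expR_ge0 ?poisson_mass_ge0.
  rewrite poisson_laplace// -EFinM big_cons; congr EFin.
  by rewrite /c; ring.
move=> j _.
have -> : pickle_inv j = Some j by exact: pickleK_inv.
rewrite /= integral_mkcond.
pose B' z := if z == y then [set j%:R%:E] else B z.
have mB' z : measurable (B' z).
  by rewrite /B'; case: eqP => // _; exact: emeasurable_set1.
rewrite (eq_integral (fun x => (expR (- (b y * j%:R)))%:E * Z s B' x)); last first.
  move=> x _; rewrite /patch; case: ifPn => xE.
    by rewrite (Z_cons _ (j := j))//; move: xE; rewrite inE.
  rewrite Z_cons0 ?mule0// => xj; move/negP: xE; apply.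
  by rewrite inE.
rewrite ge0_integralZl//; last exact: measurable_Z.
rewrite IHs// -EFinM -[RHS]EFinM; congr EFin.
rewrite (bigD1 y)//= {1}/B' eqxx (pX y j) /=.
have -> : (\prod_(z | (z \notin s) && (z != y)) fine (P [set x | B' z (X z x)]) =
    \prod_(z | z \notin y :: s) fine (P [set x | B z (X z x)]))%R.
  apply: eq_big => z; first by rewrite inE negb_or andbC.
  by rewrite /B' => /andP[_ /negbTE ->].
by rewrite /c; ring.
Qed.

Lemma poisson_vector_laplace :
  \int[P]_x \prod_y expeR (- ((b y)%:E * X y x)) =
  (expR (- \sum_y lam y * (1 - expR (- b y))))%:E.
Proof.
have := @poisson_vector_laplace_partial _ (index_enum_uniq Y) (fun=> setT).
move=> /(_ (fun=> measurableT)).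
rewrite [X in (_ * X)%R]big_pred0 => [|y]; last by rewrite mem_index_enum.
rewrite mulr1 -expR_sum -sumrN => <-.
apply: eq_integral => x _; rewrite /Z indicE mem_set ?mule1//.
Qed.

End laplace.

End poisson_vector.

Section product_expansion.
Local Open Scope set_scope.
Context (R : comPzSemiRingType) (I : finType).

Lemma prodrD_subset (J : {set I}) (s u : I -> R) :
  (\prod_(i in J) (s i + u i) = \sum_(S : {set I} | S \subset J)
    (\prod_(i in S) s i) * (\prod_(i in J :\: S) u i))%R.
Proof.
rewrite big_mkcond /=.
rewrite (eq_bigr (fun i => (if i \in J then s i else 0%R) +
    (if i \in J then u i else 1%R))%R); last first.
  by move=> i _; case: ifP => //; rewrite add0r.
rewrite bigA_distr [RHS]big_mkcond /=; apply: eq_bigr => S _.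
case: ifPn => [/fintype.subsetP SJ|/subsetPn[i iS iJ]]; last first.
  by rewrite (bigD1 i)//= iS (negbTE iJ) mul0r.
rewrite (big_mkcond (fun i => i \in S)) (big_mkcond (fun i => i \in J :\: S)).
rewrite -big_split /=; apply: eq_bigr => i _; rewrite finset.in_setD.
by case: ifPn => [/SJ ->|_]; rewrite ?mulr1 ?mul1r.
Qed.

(** Indexing by [C = i0 |: S] instead of by [S] gives the index set of [partition_recursion]. In the
    application [s i] is the increment of the i-th integral when a point is added, and [u i] its
    former value. *)
Lemma prodrD_block (J : {set I}) (s u : I -> R) (i0 : I) : i0 \in J ->
  (\prod_(i in J :\ i0) (s i + u i) =
    \sum_(C : {set I} | (i0 \in C) && (C \subset J))
      (\prod_(i in C :\ i0) s i) * (\prod_(i in J :\: C) u i))%R.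
Proof.
move=> iJ; rewrite prodrD_subset.
rewrite [RHS](reindex_onto (fun S => i0 |: S) (fun C => C :\ i0)) /=; last first.
  by move=> C /andP[iC _]; rewrite finset.setD1K.
apply: eq_big => [S|S SJ].
  rewrite finset.setU11 /= finset.subUset finset.sub1set iJ /=.
  rewrite finset.subsetD1; congr andb; apply/idP/eqP => [iS|<-].
    by rewrite finset.setU1K.
  by rewrite finset.in_setD1 eqxx.
have iS : i0 \notin S by move: SJ; rewrite finset.subsetD1 => /andP[].
rewrite finset.setU1K//; congr (_ * _)%R; apply: eq_bigl => i.
by rewrite !inE negb_or; case: (i == i0); rewrite ?andbT ?andbF.
Qed.

End product_expansion.

Section step_functions.
Context (R : realType) d (V : measurableType d) (Y : finType) (A : Y -> set V).
Context (mA : forall y, measurable (A y)) (tA : trivIset setT A).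

Definition step (a : Y -> R) (v : V) : R := (\sum_y a y * \1_(A y) v)%R.

Lemma stepE (h : V -> R) (a : Y -> R) :
  (forall y v, A y v -> h v = a y) ->
  (forall v, (forall y, ~ A y v) -> h v = 0%R) -> h = step a.
Proof.
move=> ha h0; apply/funext => v; rewrite /step.
have [[y yv]|nA] := pselect (exists y, A y v).
  rewrite (ha _ _ yv) (bigD1 y)//= indicE mem_set// mulr1 big1 ?addr0// => z zy.
  rewrite indicE memNset ?mulr0// => zv.
  by move/eqP: zy; apply; apply: tA => //; exists v.
rewrite h0 => [|y yv]; last by apply: nA; exists y.
rewrite big1// => y _; rewrite indicE memNset ?mulr0// => yv.
by apply: nA; exists y.
Qed.

Lemma step_in (a : Y -> R) y v : A y v -> step a v = a y.
Proof.
move=> yv; rewrite /step (bigD1 y)//= indicE mem_set// mulr1 big1 ?addr0// => z zy.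
rewrite indicE memNset ?mulr0// => zv.
by move/eqP: zy; apply; apply: tA => //; exists v.
Qed.

Lemma step_out (a : Y -> R) v : (forall y, ~ A y v) -> step a v = 0%R.
Proof.
by move=> nA; rewrite /step big1// => y _; rewrite indicE memNset ?mulr0.
Qed.

Lemma integral_step (mu : {measure set V -> \bar R}) (a : Y -> R) :
  (forall y, (0 <= a y)%R) ->
  \int[mu]_v (step a v)%:E = \sum_y (a y)%:E * mu (A y).
Proof.
move=> a0; under eq_integral do rewrite -sumEFin.
rewrite ge0_integral_sum//; last 2 first.
- move=> y; apply/measurable_EFinP; apply: measurable_funM => //.
- by move=> y v _; rewrite lee_fin mulr_ge0.
apply: eq_bigr => y _; under eq_integral do rewrite EFinM.
rewrite ge0_integralZl//; last 2 first.
- exact/measurable_EFinP.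
- by rewrite lee_fin.
by rewrite integral_indic// setIT.
Qed.

End step_functions.

Lemma expeRN_sum (R : realType) (J : Type) (s : seq J) (u : J -> \bar R) :
  (forall j, 0 <= u j) ->
  expeR (- \sum_(j <- s) u j) = \prod_(j <- s) expeR (- u j).
Proof.
move=> u0; elim: s => [|j s IHs]; first by rewrite !big_nil oppe0 expeR0.
rewrite !big_cons -IHs -expeRD oppeD//; apply: ge0_adde_def; rewrite inE ?sume_ge0//.
Qed.

Section poisson_step_functions.
Context (R : realType) (V : completeMetricType R).
Context (rho : {measure set (borel V) -> \bar R}).
Context d (T : measurableType d) (P : probability T R).
Context (N : R.-ker T ~> borel V) (hN : poisson_random_measure P rho N).
Context (Y : finType) (A : Y -> set (borel V)).
Context (mA : forall y, measurable (A y)) (tA : trivIset setT A).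
Context (Afin : forall y, rho (A y) < +oo).
Context (I : finType) (a : I -> Y -> R) (b : Y -> R).
Context (a0 : forall i y, (0 <= a i y)%R) (b0 : forall y, (0 <= b y)%R).

Let X y (x : T) : \bar R := N x (A y).
Let lam y : R := fine (rho (A y)).

Let mX y : measurable_fun setT (X y).
Proof. exact: measurable_kernel. Qed.

Let lam0 y : (0 <= lam y)%R.
Proof. exact: fine_ge0. Qed.

Let pX y (k : nat) : P [set x | X y x = k%:R%:E] = (poisson_mass (lam y) k)%:E.
Proof. exact: (prm_poisson hN). Qed.

Let indX (B : Y -> set (\bar R)) : (forall y, measurable (B y)) ->
  P [set x | forall y, B y (X y x)] = \prod_(y : Y) P [set x | B y (X y x)].
Proof.
move=> mB.
have tA' : trivIset setT (fun i : 'I_#|Y| => A (enum_val i)).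
  by move=> i j _ _ /tA -/(_ Logic.I Logic.I) /enum_val_inj.
have := prm_independent hN (fun i => mA (enum_val i)) tA' (B := fun i => B (enum_val i)).
move=> /(_ (fun i => mB (enum_val i))) H.
rewrite (reindex (fun i : 'I_#|Y| => enum_val i)) /=; last first.
  by apply: onW_bij; exact: enum_val_bij.
rewrite -[RHS]H; congr (P _); apply/seteqP; split => x /= xB i; first exact: xB.
by have := xB (enum_rank i); rewrite enum_rankK.
Qed.

Let f i : V -> R := step A (a i).
Let g : V -> R := step A b.

Let random_step (c : Y -> R) x : (forall y, (0 <= c y)%R) ->
  random_integral N (step A c) x = \sum_y (c y)%:E * X y x.
Proof. by move=> c0; rewrite /random_integral (integral_step mA). Qed.

Let random_step_count (c : Y -> R) (k : {ffun Y -> nat}) x :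
  (forall y, (0 <= c y)%R) -> count_event X k x ->
  random_integral N (step A c) x = (\sum_y c y * (k y)%:R)%:E.
Proof.
move=> c0 xk; rewrite random_step// -sumEFin; apply: eq_bigr => y _.
by rewrite xk.
Qed.

Let measurable_random_step (c : Y -> R) : (forall y, (0 <= c y)%R) ->
  measurable_fun setT (random_integral N (step A c)).
Proof.
move=> c0; rewrite (_ : random_integral _ _ = fun x => \sum_y (c y)%:E * X y x).
  by apply: emeasurable_sum => y; exact: measurable_funeM.
by apply/funext => x; rewrite random_step.
Qed.

Let random_step_ge0 (c : Y -> R) x : (forall y, (0 <= c y)%R) ->
  0 <= random_integral N (step A c) x.
Proof.
move=> c0; rewrite random_step// sume_ge0// => y _.
by rewrite mule_ge0// lee_fin.
Qed.

(** For nonempty [C] this is the integral against [rho] of the product of the [f i] over [C] times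
    [expR (- g)]; off the cells that product vanishes. *)
Definition step_block (C : {set I}) : R :=
  (\sum_y \prod_(i in C) a i y * expR (- b y) * lam y)%R.

Let K (J : {set I}) (x : T) : \bar R :=
  expeR (- random_integral N g x) * \prod_(i in J) random_integral N (f i) x.

Let K_ge0 J x : 0 <= K J x.
Proof.
by rewrite mule_ge0 ?expeR_ge0// prode_ge0// => i _; exact: random_step_ge0.
Qed.

Let measurable_K J : measurable_fun setT (K J).
Proof.
apply: emeasurable_funM.
  apply: measurableT_comp; first exact: measurable_expeR.
  by apply: measurableT_comp => //; exact: measurable_random_step.
rewrite (_ : (fun x => _) = (fun x => \prod_(i <- enum J) random_integral N (f i) x)).
  by apply: emeasurable_prod => i; exact: measurable_random_step.
by apply/funext => x; rewrite big_enum.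
Qed.

Let laplace_step : \int[P]_x expeR (- random_integral N g x) =
  (expR (- \sum_y lam y * (1 - expR (- b y))))%:E.
Proof.
rewrite -(poisson_vector_laplace mX lam0 pX indX b).
apply: eq_integral => x _; rewrite random_step// expeRN_sum// => y.
by rewrite mule_ge0// lee_fin.
Qed.

(* Mecke's equation applied to the factor [i0] splits off the block [C] of [i0],
   which is the recursion satisfied by the sum over partitions. *)
Lemma poisson_step_moment (J : {set I}) : \int[P]_x K J x =
  (expR (- \sum_y lam y * (1 - expR (- b y))) *
   \sum_(p : {set {set I}} | finset.partition p J) \prod_(C in p) step_block C)%:E.
Proof.
have [m] := ubnP #|J|; elim: m => // m IHm in J *.
rewrite ltnS => Jm.
have [->|/finset.set0Pn[i0 iJ]] := eqVneq J finset.set0.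
  rewrite (big_pred1 finset.set0) => [|p]; last exact: partition_set0.
  rewrite big_set0 mulr1 -laplace_step; apply: eq_integral => x _.
  by rewrite /K big_set0 mule1.
rewrite (partition_recursion _ iJ).
set L := expR _ in IHm *.
pose Q (B : {set I}) := (\sum_(p : {set {set I}} | finset.partition p B)
  \prod_(C in p) step_block C)%R.
have QE (C : {set I}) : i0 \in C -> C \subset J ->
    \int[P]_x K (J :\: C)%SET x = (L * Q (J :\: C)%SET)%:E.
  move=> iC CJ; apply: IHm; apply: leq_trans Jm.
  apply: fintype.proper_card; apply/properP; split; first exact: finset.subsetDl.
  by exists i0 => //; rewrite finset.in_setD iC.
(* One more point in the cell [A y] multiplies the exponential by [expR (- b y)] and adds [a i y] to
   the integral of [f i]. [H2 y] is [K (J :\ i0)] after this change, expanded by [prodrD_block]. *)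
pose H1 y x := X y x * K (J :\ i0)%SET x.
pose H2 y x := \sum_(C : {set I} | (i0 \in C) && (C \subset J))
  (expR (- b y) * \prod_(i in (C :\ i0)%SET) a i y)%:E * K (J :\: C)%SET x.
have H20 y x : 0 <= H2 y x.
  apply: sume_ge0 => C _; rewrite mule_ge0// lee_fin mulr_ge0 ?expR_ge0//.
  by apply: prodr_ge0 => i _.
have H10 y x : 0 <= H1 y x by rewrite mule_ge0.
have mecke y : \int[P]_x H1 y x = (lam y)%:E * \int[P]_x H2 y x.
  pose F (k : {ffun Y -> nat}) : R := (expR (- \sum_z b z * (k z)%:R) *
     \prod_(i in (J :\ i0)%SET) \sum_z a i z * (k z)%:R)%R.
  have KE k x (B : {set I}) : count_event X k x -> K B x =
      (expR (- \sum_z b z * (k z)%:R) *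
       \prod_(i in B) \sum_z a i z * (k z)%:R)%:E.
    move=> xk; rewrite /K (random_step_count b0 xk) /= EFinM -prodEFin.
    by congr (_ * _); apply: eq_bigr => i _; rewrite (random_step_count (a0 i) xk).
  apply: (poisson_mecke mX lam0 pX indX (F := F)).
  - exact: emeasurable_funM.
  - exact: H10.
  - rewrite (_ : H2 y = fun x =>
        \sum_(C <- enum [pred C : {set I} | (i0 \in C) && (C \subset J)])
          (expR (- b y) * \prod_(i in (C :\ i0)%SET) a i y)%:E * K (J :\: C)%SET x).
      by apply: emeasurable_sum => C; exact: measurable_funeM.
    by apply/funext => x; rewrite big_enum.
  - exact: H20.
  - move=> k; rewrite mulr_ge0 ?expR_ge0//; apply: prodr_ge0 => i _.
    by apply: sumr_ge0 => z _; rewrite mulr_ge0.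
  - by move=> k x xk; rewrite /H1 (KE _ _ _ xk) xk.
  - move=> k x xk.
    have sumE (c : Y -> R) : (\sum_z c z * ([ffun z => (k z + (z == y))%N] z)%:R =
        c y + \sum_z c z * (k z)%:R)%R.
      rewrite (bigD1 y)//= [in RHS](bigD1 y)//= ffunE eqxx natrD mulrDr mulr1.
      rewrite addrA [(c y * _ + _)%R]addrC; congr (_ + _)%R; apply: eq_bigr => z zy.
      by rewrite ffunE (negbTE zy) addn0.
    rewrite /F sumE.
    under [in RHS]eq_bigr do rewrite sumE.
    rewrite (prodrD_block _ _ iJ) mulr_sumr -sumEFin; apply: eq_bigr => C _.
    rewrite (KE _ _ _ xk) -EFinM; congr EFin.
    rewrite opprD expRD; ring.
(* The integral of [f i0] is linear in the counts, which supplies the factor [X y] on which Mecke's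
   equation acts. *)
have -> : \int[P]_x K J x = \sum_y (a i0 y)%:E * \int[P]_x H1 y x.
  transitivity (\int[P]_x \sum_y (a i0 y)%:E * H1 y x).
    apply: eq_integral => x _; rewrite /H1.
    under eq_bigr do rewrite muleA.
    rewrite -ge0_sume_distrl; last first.
      by move=> y _; rewrite mule_ge0// lee_fin.
    by rewrite -random_step// /K (big_setD1 i0)//= muleCA.
  rewrite ge0_integral_sum//; last 2 first.
  - move=> y; apply: measurable_funeM; exact: emeasurable_funM.
  - by move=> y x _; rewrite mule_ge0 ?lee_fin.
  apply: eq_bigr => y _; rewrite ge0_integralZl//.
  - exact: emeasurable_funM.
  - by rewrite lee_fin.
have H2E y : \int[P]_x H2 y x =
    (\sum_(C : {set I} | (i0 \in C) && (C \subset J))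
      (expR (- b y) * \prod_(i in (C :\ i0)%SET) a i y) * (L * Q (J :\: C)%SET))%:E.
  rewrite /H2 -sumEFin.
  transitivity (\sum_(C <- enum [pred C : {set I} | (i0 \in C) && (C \subset J)])
     \int[P]_x ((expR (- b y) * \prod_(i in (C :\ i0)%SET) a i y)%:E * K (J :\: C)%SET x)).
    rewrite -ge0_integral_sum//.
    - by apply: eq_integral => x _; rewrite big_enum.
    - by move=> C; exact: measurable_funeM.
    - move=> C x _; rewrite mule_ge0// lee_fin mulr_ge0 ?expR_ge0//.
      by apply: prodr_ge0 => i _.
  rewrite big_enum /=; apply: eq_bigr => C /andP[iC CJ].
  rewrite ge0_integralZl//; first by rewrite QE// -EFinM.
  rewrite lee_fin mulr_ge0 ?expR_ge0//.
  by apply: prodr_ge0 => i _.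
under eq_bigr => y _ do rewrite mecke H2E -!EFinM.
rewrite sumEFin; congr EFin.
change (\sum_y a i0 y * (lam y * \sum_(C : {set I} | (i0 \in C) && (C \subset J))
    expR (- b y) * \prod_(i in (C :\ i0)%SET) a i y * (L * Q (J :\: C)%SET)) =
  L * \sum_(C : {set I} | (i0 \in C) && (C \subset J))
    step_block C * Q (J :\: C)%SET)%R.
clearbody Q L.
(* For fixed [C], the weights [a i0 y * lam y * expR (- b y)] times the product of the [a i y] over
   [C :\ i0] sum over [y] to [step_block C]; hence the exchange of sums. *)
under eq_bigr do rewrite 2!mulr_sumr.
rewrite exchange_big /= mulr_sumr; apply: eq_bigr => C /andP[iC CJ].
rewrite /step_block mulr_suml mulr_sumr; apply: eq_bigr => y _.
rewrite (big_setD1 i0 iC) /=; ring.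
Qed.

End poisson_step_functions.

(** * Monotone and finite limits of extended reals *)

Section increasing_limits.
Context (R : realType).

(** Positivity and monotonicity travel with the convergence: they keep sums, products and integrals
    convergent in [0, +oo] even when limits are infinite. *)
Definition cvg_up (u : nat -> \bar R) (a : \bar R) : Prop :=
  [/\ forall n, 0 <= u n, {homo u : m n / (m <= n)%N >-> m <= n} &
      u @ \oo --> a].

Lemma cvg_up_ge0 u a : cvg_up u a -> 0 <= a.
Proof.
move=> [u0 _ ua]; rewrite -(cvg_lim _ ua)//.
by apply: lime_ge => //; [apply/cvg_ex; exists a|exact: nearW].
Qed.

Lemma cvg_up_le u a n : cvg_up u a -> u n <= a.
Proof.
move=> [u0 nd ua].
rewrite (cvg_unique _ ua (ereal_nondecreasing_cvgn nd))//.
by apply: ereal_sup_ubound; exists n.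
Qed.

Lemma cvg_up_cst a : 0 <= a -> cvg_up (fun=> a) a.
Proof. by move=> a0; split => //; exact: cvg_cst. Qed.

Lemma cvg_upD u v a b : cvg_up u a -> cvg_up v b ->
  cvg_up (fun n => u n + v n) (a + b).
Proof.
move=> ua vb; have a0 := cvg_up_ge0 ua; have b0 := cvg_up_ge0 vb.
case: ua vb => [u0 un ua] [v0 vn vb]; split => [n|m n mn|].
- exact: adde_ge0.
- by apply: leeD; [exact: un|exact: vn].
- by apply: cvgeD => //; exact: ge0_adde_def.
Qed.

(* No condition excludes [0 * +oo]: if the limit is 0 then so is every term. *)
Lemma cvg_upM u v a b : cvg_up u a -> cvg_up v b ->
  cvg_up (fun n => u n * v n) (a * b).
Proof.
move=> ua vb; have a0 := cvg_up_ge0 ua; have b0 := cvg_up_ge0 vb.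
have uz n : a = 0 -> u n = 0.
  move=> az; apply/eqP; rewrite eq_le; case: (ua) => -> _ _.
  by rewrite -[X in _ <= X]az (cvg_up_le n ua).
have vz n : b = 0 -> v n = 0.
  move=> bz; apply/eqP; rewrite eq_le; case: (vb) => -> _ _.
  by rewrite -[X in _ <= X]bz (cvg_up_le n vb).
case: ua vb => [u0 un ua] [v0 vn vb]; split => [n|m n mn|].
- exact: mule_ge0.
- by apply: lee_pmul => //; [exact: un|exact: vn].
- have [az|an0] := eqVneq a 0.
    rewrite az mul0e (_ : (fun _ => _) = cst 0); first exact: cvg_cst.
    by apply/funext => n; rewrite uz// mul0e.
  have [bz|bn0] := eqVneq b 0.
    rewrite bz mule0 (_ : (fun _ => _) = cst 0); first exact: cvg_cst.
    by apply/funext => n; rewrite vz// mule0.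
  apply: cvgeM => //.
  by rewrite mule_defE (negbTE an0) (negbTE bn0).
Qed.

Lemma cvg_up_sum (J : Type) (s : seq J) (Q : pred J) (u : nat -> J -> \bar R) a :
  (forall j, Q j -> cvg_up (u ^~ j) (a j)) ->
  cvg_up (fun n => \sum_(j <- s | Q j) u n j) (\sum_(j <- s | Q j) a j).
Proof.
move=> ua; elim: s => [|j s IHs].
  rewrite big_nil; under eq_fun do rewrite big_nil; exact: cvg_up_cst.
rewrite big_cons; under eq_fun do rewrite big_cons.
by case: ifP => // /ua Qj; exact: cvg_upD.
Qed.

Lemma cvg_up_prod (J : Type) (s : seq J) (Q : pred J) (u : nat -> J -> \bar R) a :
  (forall j, Q j -> cvg_up (u ^~ j) (a j)) ->
  cvg_up (fun n => \prod_(j <- s | Q j) u n j) (\prod_(j <- s | Q j) a j).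
Proof.
move=> ua; elim: s => [|j s IHs].
  rewrite big_nil; under eq_fun do rewrite big_nil; exact: cvg_up_cst.
rewrite big_cons; under eq_fun do rewrite big_cons.
by case: ifP => // /ua Qj; exact: cvg_upM.
Qed.

Lemma cvg_up_integral d (T : measurableType d) (mu : {measure set T -> \bar R})
    (h : nat -> T -> \bar R) (H : T -> \bar R) :
  (forall n, measurable_fun setT (h n)) ->
  (forall x, cvg_up (h ^~ x) (H x)) ->
  cvg_up (fun n => \int[mu]_x h n x) (\int[mu]_x H x).
Proof.
move=> mh hH.
have h0 n x : 0 <= h n x by case: (hH x) => h0 _ _; exact: h0.
have nd x : {homo h ^~ x : m n / (m <= n)%N >-> m <= n}.
  by case: (hH x).
split.
- by move=> n; apply: integral_ge0 => x _; exact: h0.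
- by move=> m n mn; apply: ge0_le_integral => // x _; exact: nd.
- rewrite (_ : \int[mu]_x H x = \int[mu]_x limn (h ^~ x)).
    by apply: cvg_monotone_convergence => // x _; exact: nd.
  by apply: eq_integral => x _; apply/esym/cvg_lim => //; case: (hH x).
Qed.

Lemma cvg_up_unique u a b : cvg_up u a -> cvg_up u b -> a = b.
Proof. by move=> [_ _ ua] [_ _ ub]; exact: (cvg_unique _ ua ub). Qed.

End increasing_limits.

Section finite_limits.
Context (R : realType).

(** Serves the passage to the limit in [g], where the sequences decrease; finite limits keep the
    products away from [0 * +oo]. *)
Definition cvg_fin (u : nat -> \bar R) (a : \bar R) : Prop :=
  a \is a fin_num /\ u @ \oo --> a.

Lemma cvg_fin_cst a : a \is a fin_num -> cvg_fin (fun=> a) a.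
Proof. by split => //; exact: cvg_cst. Qed.

Lemma cvg_finM u v a b : cvg_fin u a -> cvg_fin v b ->
  cvg_fin (fun n => u n * v n) (a * b).
Proof.
move=> [fa ua] [fb vb]; split; first exact: fin_numM.
by apply: cvgeM => //; exact: mule_def_fin.
Qed.

Lemma cvg_fin_sum (J : Type) (s : seq J) (Q : pred J) (u : nat -> J -> \bar R) a :
  (forall j, Q j -> cvg_fin (u ^~ j) (a j)) ->
  cvg_fin (fun n => \sum_(j <- s | Q j) u n j) (\sum_(j <- s | Q j) a j).
Proof.
move=> ua; elim: s => [|j s IHs].
  rewrite big_nil; under eq_fun do rewrite big_nil; exact: cvg_fin_cst.
rewrite big_cons; under eq_fun do rewrite big_cons.
case: ifP => // /ua [fj uj]; case: IHs => fs us; split; first by rewrite fin_numD fj.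
by apply: cvgeD => //; exact: fin_num_adde_defl.
Qed.

Lemma cvg_fin_prod (J : Type) (s : seq J) (Q : pred J) (u : nat -> J -> \bar R) a :
  (forall j, Q j -> cvg_fin (u ^~ j) (a j)) ->
  cvg_fin (fun n => \prod_(j <- s | Q j) u n j) (\prod_(j <- s | Q j) a j).
Proof.
move=> ua; elim: s => [|j s IHs].
  rewrite big_nil; under eq_fun do rewrite big_nil; exact: cvg_fin_cst.
rewrite big_cons; under eq_fun do rewrite big_cons.
by case: ifP => // /ua Qj; exact: cvg_finM.
Qed.

(** The case [a = +oo] is included because N(g) and Lambda(g) may be infinite; the exponentials then
    tend to 0. *)
Lemma cvg_expeRN (u : nat -> \bar R) (a : \bar R) : -oo < a ->
  u @ \oo --> a -> expeR (- u n) @[n --> \oo] --> expeR (- a).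
Proof.
case: a => [r| |]// _ ua.
  have [ufin ur] := (fine_cvgP _ _).1 ua.
  have er : expR (- fine (u n)) @[n --> \oo] --> expR (- r).
    apply: (@cvg_comp _ _ _ (fun n => - fine (u n))%R expR); first exact: (cvgN ur).
    exact: continuous_expR.
  apply: cvg_EFin.
    by apply: filterS ufin => n; case: (u n).
  apply: cvg_trans er; apply: near_eq_cvg.
  near=> n; have un : u n \is a fin_num by near: n.
  by rewrite /= -{2}(fineK un).
apply/fine_cvgP; split.
  have /cvgeyPge/(_ 0%R) := ua; apply: filterS => n.
  by case: (u n).
apply/cvgr0Pnorm_lt => e e0.
have /cvgeyPgt/(_ (- ln e)%R) := ua; apply: filterS => n.
rewrite /=; case: (u n) => [r| |] /=; [|by rewrite normr0|by rewrite ltNge leNye].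
rewrite lte_fin => er; rewrite ger0_norm ?expR_ge0//.
by rewrite -[ltRHS]lnK ?posrE// ltr_expR ltrNl.
Unshelve. all: by end_near.
Qed.

End finite_limits.

Section simple_functions.
Import HBNNSimple.
Context (R : realType) d (V : measurableType d).

Definition simple_on (D : set V) (s : V -> R) : Prop :=
  [/\ measurable_fun setT s, finite_set (range s), forall v, (0 <= s v)%R &
      forall v, ~ D v -> s v = 0%R].

Lemma simple_on_sub (D E : set V) s : D `<=` E -> simple_on D s -> simple_on E s.
Proof. by move=> DE [ms fs s0 sD]; split => // v nE; apply: sD => /DE. Qed.

Lemma simple_on0 (D : set V) : simple_on D (fun=> 0%R).
Proof.
split => //; apply: (@sub_finite_set _ _ [set 0%R]); last exact: finite_set1.
by move=> _ [v _ <-].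
Qed.

(** The cells are the joint level sets inside [D]: an index [y] prescribes the values of all the
    [u j] at once, so one family of disjoint sets serves every function. *)
Lemma simple_on_step (D : set V) (J : finType) (u : J -> V -> R) :
  measurable D -> (forall j, simple_on D (u j)) ->
  exists (Y : finType) (A : Y -> set V) (a : J -> Y -> R),
    [/\ forall y, measurable (A y), trivIset setT A, forall y, A y `<=` D,
        forall j y, (0 <= a j y)%R & forall j, u j = step A (a j)].
Proof.
move=> mD hu.
have /all_sig[r rE] : forall j, {r : seq R | range (u j) = [set` r]}.
  by move=> j; apply/cid; case: (hu j) => _ /finite_seqP.
pose rr := flatten [seq r j | j <- enum J].
have rrP j v : u j v \in rr.
  apply/flattenP; exists (r j); first by apply/mapP; exists j => //; rewrite mem_enum.
  by have : range (u j) (u j v) by []; rewrite rE.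
(* The absolute value makes every coefficient visibly nonnegative, also on an empty cell; on a
   nonempty cell it is the value of [u j]. *)
exists {ffun J -> seq_sub rr},
  (fun y : {ffun J -> seq_sub rr} => [set v | D v /\ forall j, u j v = ssval (y j)]),
  (fun j (y : {ffun J -> seq_sub rr}) => `|ssval (y j)|)%R.
have tA : trivIset setT (fun y : {ffun J -> seq_sub rr} =>
    [set v | D v /\ forall j, u j v = ssval (y j)]).
  move=> y z _ _ [v [[_ vy] [_ vz]]]; apply/ffunP => j; apply: val_inj => /=.
  by rewrite -vy -vz.
split => //.
- move=> y; apply: measurableI => //.
  apply: (measurable_forall (E := fun j => [set v | u j v = ssval (y j)])) => j.
  rewrite -[X in measurable X]setTI; case: (hu j) => mu _ _ _.
  exact: (mu measurableT [set ssval (y j)] (measurable_set1 _)).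
- by move=> y v [].
- move=> j; apply: stepE => // [y v [_ /(_ j)]|v nA].
    by move=> <-; rewrite ger0_norm//; case: (hu j).
  case: (hu j) => _ _ _; apply => Dv.
  apply: (nA [ffun j => SeqSub (rrP j v)]); split => // k.
  by rewrite ffunE.
Qed.

Lemma simple_on_approx (D : nat -> set V) (F : V -> R) :
  (forall m, measurable (D m)) -> {homo D : m n / (m <= n)%N >-> m `<=` n} ->
  (forall v, exists m, D m v) ->
  measurable_fun setT F -> (forall v, (0 <= F v)%R) ->
  exists s : nat -> V -> R, (forall m, simple_on (D m) (s m)) /\
    forall v, cvg_up (fun m => (s m v)%:E) (F v)%:E.
Proof.
move=> mD ndD UD mF F0.
have mF' : measurable_fun setT (EFin \o F) by exact/measurable_EFinP.
pose u := nnsfun_approx measurableT mF'.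
(* The cut-off by [D m] gives the support condition; at a fixed [v] it is inactive as soon as [v]
   lies in [D m], so the limit is unchanged. *)
exists (fun m v => (u m v * \1_(D m) v)%R); split.
  move=> m; split.
  - by apply: measurable_funM.
  - apply: (@sub_finite_set _ _ (range (u m) `|` [set 0%R])).
      move=> _ [v _ <-]; rewrite indicE; case: (v \in D m); rewrite ?mulr1 ?mulr0.
        by left; exists v.
      by right.
    by rewrite finite_setU; split; [exact: fimfunP|exact: finite_set1].
  - by move=> v; rewrite mulr_ge0.
  - by move=> v nD; rewrite indicE memNset ?mulr0.
move=> v; split.
- by move=> m; rewrite lee_fin mulr_ge0.
- move=> m n mn; rewrite lee_fin ler_pM//.
    by have /lefP := nd_nnsfun_approx measurableT mF' mn; exact.
  rewrite !indicE; case: (boolP (v \in D m)) => //; rewrite inE => vD.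
  by rewrite mem_set//; exact: ndD vD.
- have uv : (u m v)%:E @[m --> \oo] --> (F v)%:E.
    by apply: (cvg_nnsfun_approx measurableT mF') => // x _; rewrite lee_fin.
  apply: cvg_trans uv; apply: near_eq_cvg.
  have [m0 vm0] := UD v; near=> m.
  rewrite indicE mem_set ?mulr1//; apply: ndD vm0; near: m; exact: nbhs_infty_ge.
Unshelve. all: by end_near.
Qed.

End simple_functions.

Section balls.
Context (R : realType) (V : completeMetricType R).

Lemma measurable_ball_borel (x : V) (r : R) : measurable (ball x r : set (borel V)).
Proof.
apply: sub_sigma_algebra => /=.
rewrite openE => y; rewrite ballEmdist /= => xy.
apply/nbhs_ballP; exists (r - mdist x y)%R => /=; first by rewrite subr_gt0.
move=> z; rewrite !ballEmdist /= ltrBrDl; apply: le_lt_trans.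
exact: metric_triangle.
Qed.

(** An increasing exhaustion by bounded sets, on each of which a boundedly finite intensity and
    every realization [N x] are finite. The centre is arbitrary. *)
Definition cover_ball (m : nat) : set (borel V) := ball (point : V) (m%:R : R).

Lemma measurable_cover_ball m : measurable (cover_ball m).
Proof. exact: measurable_ball_borel. Qed.

Lemma cover_ball_nd : {homo cover_ball : m n / (m <= n)%N >-> m `<=` n}.
Proof.
move=> m n mn v; rewrite /cover_ball !ballEmdist /= => /lt_le_trans; apply.
by rewrite ler_nat.
Qed.

Lemma cover_ball_cover v : exists m, cover_ball m v.
Proof.
exists (Num.bound (mdist (point : V) v)); rewrite /cover_ball ballEmdist /=.
by apply: archi_boundP; exact: mdist_ge0.
Qed.

Lemma cover_ball_approx (I : Type) (f : I -> V -> R) :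
  (forall i, measurable_fun [set: borel V] (f i)) -> (forall i v, (0 <= f i v)%R) ->
  exists s : nat -> I -> V -> R,
    (forall m i, simple_on (cover_ball m : set (borel V)) (s m i)) /\
    forall i v, cvg_up (fun m => (s m i v)%:E) (f i v)%:E.
Proof.
move=> mf f0.
have /all_sig[s sf] : forall i, {s : nat -> V -> R |
    (forall m, simple_on (cover_ball m : set (borel V)) (s m)) /\
    forall v, cvg_up (fun m => (s m v)%:E) (f i v)%:E}.
  move=> i; apply/cid; exact: (simple_on_approx measurable_cover_ball
    cover_ball_nd cover_ball_cover (mf i) (f0 i)).
by exists (fun m i => s i m); split=> [m i|i]; case: (sf i).
Qed.

Lemma cover_ball_fin (rho : set (borel V) -> \bar R) m :
  boundedly_finite rho -> rho (cover_ball m) < +oo.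
Proof.
move=> hrho; apply: hrho; first exact: measurable_cover_ball.
by exists point, m%:R%R.
Qed.

End balls.

(** * Moments of Poisson random measures *)

Section poisson_moments.
Context (R : realType) (V : completeMetricType R).
Context (rho : {measure set (borel V) -> \bar R}) (hrho : boundedly_finite rho).
Context d (T : measurableType d) (P : probability T R).
Context (N : R.-ker T ~> borel V) (hN : poisson_random_measure P rho N).
Context (I : finType).
Implicit Types (f : I -> V -> R) (g : V -> R).

Definition block_integral f g (C : {set I}) : \bar R :=
  \int[rho]_v (\prod_(i in C) f i v * expR (- g v))%R%:E.

Definition moment_sum f g : \bar R :=
  \sum_(p : {set {set I}} | finset.partition p [set: I]%SET)
    \prod_(C in p) block_integral f g C.

Definition tilted_moment f g : \bar R :=
  \int[P]_x (expeR (- random_integral N g x) * \prod_i random_integral N (f i) x).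

Lemma measurable_random_integral (h : V -> R) :
  measurable_fun [set: borel V] h -> (forall v, (0 <= h v)%R) ->
  measurable_fun setT (random_integral N h).
Proof.
move=> mh h0; apply: (measurable_fun_integral_kernel (l := N)).
- by move=> U mU; exact: measurable_kernel.
- by move=> v; rewrite lee_fin.
- exact/measurable_EFinP.
Qed.

Lemma random_integral_ge0 (h : V -> R) x :
  (forall v, (0 <= h v)%R) -> 0 <= random_integral N h x.
Proof. by move=> h0; apply: integral_ge0 => v _; rewrite lee_fin. Qed.

Lemma measurable_expeRN_random (h : V -> R) :
  measurable_fun [set: borel V] h -> (forall v, (0 <= h v)%R) ->
  measurable_fun setT (fun x => expeR (- random_integral N h x)).
Proof.
move=> mh h0; apply: measurableT_comp; first exact: measurable_expeR.
by apply: measurableT_comp => //; exact: measurable_random_integral.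
Qed.

(** An empty block would contribute the integral of [expR (- g)] over the whole space, possibly
    infinite; a member [i] confines the integrand to the support of [f i]. *)
Lemma partition_block_neq0 (p : {set {set I}}) (C : {set I}) :
  finset.partition p [set: I]%SET -> C \in p -> exists i, i \in C.
Proof. by move=> /partition_neq0 /[apply] /finset.set0Pn. Qed.

(** The finiteness clauses, taken at [g = 0], supply the integrable bounds when a general [g] is
    approximated. *)
Lemma poisson_moment_simple f g m :
  (forall i, simple_on (cover_ball m : set (borel V)) (f i)) ->
  simple_on (cover_ball m : set (borel V)) g ->
  [/\ tilted_moment f g = expeR (- Lambda rho g) * moment_sum f g,
      tilted_moment f g \is a fin_num &
      forall (C : {set I}) i, i \in C -> block_integral f g C \is a fin_num].
Proof.
move=> sf sg.
(* Indexing by [option I], with [None] standing for [g], gives the [f i] and [g] common cells. *)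
have [Y [A [c [mA tA AD c0 cE]]]] := @simple_on_step _ _ (borel V) (cover_ball m)
  (option I) (oapp f g) (measurable_cover_ball m)
  ltac:(by case).
have Afin y : rho (A y) < +oo.
  apply: le_lt_trans (cover_ball_fin m hrho); apply: le_measure; rewrite ?inE//.
  exact: measurable_cover_ball.
pose a i := c (Some i); pose b := c None.
have fE i : f i = step A (a i) by exact: (cE (Some i)).
have gE : g = step A b by exact: (cE None).
have rhoE y : (fine (rho (A y)))%:E = rho (A y).
  by rewrite fineK// ge0_fin_numE.
have blockE (C : {set I}) i : i \in C ->
    block_integral f g C = (step_block rho A a b C)%:E.
  move=> iC.
  rewrite /block_integral (_ : (fun v => _) =
      EFin \o step A (fun y => \prod_(i in C) a i y * expR (- b y))%R).
    rewrite (integral_step mA); last first.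
      move=> y; rewrite mulr_ge0 ?expR_ge0//; apply: prodr_ge0 => j _; exact: c0.
    rewrite /step_block -sumEFin; apply: eq_bigr => y _.
    by rewrite -rhoE -EFinM.
  rewrite -(@stepE _ _ _ Y A tA (fun v => \prod_(i in C) f i v * expR (- g v))%R)//.
    move=> y v yv; rewrite gE (step_in tA _ yv); congr (_ * _)%R.
    by apply: eq_bigr => j _; rewrite fE (step_in tA _ yv).
  move=> v nA; rewrite (bigD1 i)//= fE step_out// !mul0r//.
have LE : Lambda rho g = (\sum_y fine (rho (A y)) * (1 - expR (- b y)))%:E.
  rewrite /Lambda (_ : (fun v => _) = EFin \o step A (fun y => 1 - expR (- b y))%R).
    rewrite (integral_step mA); last first.
      by move=> y; rewrite subr_ge0 -expR0 ler_expR lerNl oppr0 c0.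
    by rewrite -sumEFin; apply: eq_bigr => y _; rewrite EFinM rhoE muleC.
  rewrite -(@stepE _ _ _ Y A tA (fun v => 1 - expR (- g v))%R)//.
    by move=> y v yv; rewrite gE (step_in tA _ yv).
  by move=> v nA; rewrite gE step_out// oppr0 expR0 subrr.
have mainE : tilted_moment f g = (expR (- \sum_y fine (rho (A y)) * (1 - expR (- b y))) *
   \sum_(p : {set {set I}} | finset.partition p [set: I]%SET)
     \prod_(C in p) step_block rho A a b C)%:E.
  rewrite -(poisson_step_moment hN mA tA Afin (fun i => c0 (Some i)) (c0 None)).
  apply: eq_integral => x _; rewrite gE; congr (_ * _).
  by apply: eq_big => [i|i _]; rewrite ?finset.inE ?fE.
split.
- rewrite mainE LE /= EFinM /moment_sum -sumEFin; congr (_ * _).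
  apply: eq_bigr => p pP; rewrite -prodEFin; apply: eq_bigr => C Cp.
  by have [i iC] := partition_block_neq0 pP Cp; rewrite (blockE _ _ iC).
- by rewrite mainE.
- by move=> C i iC; rewrite (blockE _ _ iC).
Qed.

(** [N x] is boundedly finite for every [x], so finiteness holds everywhere and not only almost
    surely. *)
Lemma finite_random_integral (s : V -> R) m x :
  simple_on (cover_ball m : set (borel V)) s -> random_integral N s x \is a fin_num.
Proof.
move=> ss.
have [Y [A [c [mA tA AD c0 cE]]]] := @simple_on_step _ _ (borel V) (cover_ball m)
  unit (fun=> s) (measurable_cover_ball m) (fun=> ss).
rewrite /random_integral (cE tt) (integral_step mA)//.
apply/sum_fin_numP => y _ _; rewrite fin_numM// ge0_fin_numE//.
apply: le_lt_trans (cover_ball_fin m (prm_boundedly_finite hN x)).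
by apply: le_measure; rewrite ?inE//; exact: measurable_cover_ball.
Qed.

(* [g] is approximated before the [f i] are: with [f] simple and boundedly
   supported all moments are finite, which dominates the decreasing sequence
   [exp(- N(t n))]. *)
Lemma poisson_moment_simple_weights f g m :
  (forall i, simple_on (cover_ball m : set (borel V)) (f i)) ->
  measurable_fun [set: borel V] g -> (forall v, (0 <= g v)%R) ->
  tilted_moment f g = expeR (- Lambda rho g) * moment_sum f g.
Proof.
move=> sf mg g0.
have mf i : measurable_fun [set: borel V] (f i) by case: (sf i).
have f0 i v : (0 <= f i v)%R by case: (sf i) => _ _ + _; exact.
have [t [st tg]] := simple_on_approx (@measurable_cover_ball _ V)
  (@cover_ball_nd _ V) (@cover_ball_cover _ V) mg g0.
have mt n : measurable_fun [set: borel V] (t n) by case: (st n).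
have t0 n v : (0 <= t n v)%R by case: (st n) => _ _ + _; exact.
have tgR v : t n v @[n --> \oo] --> g v.
  by case: (tg v) => _ _ /fine_cvgP[].
(* The [f i] are supported in the ball of radius [m] and [t n] in that of radius [n]; the larger
   ball carries both. *)
have max_ball n : [/\ tilted_moment f (t n) =
      expeR (- Lambda rho (t n)) * moment_sum f (t n) ,
      tilted_moment f (t n) \is a fin_num &
      forall (C : {set I}) i, i \in C -> block_integral f (t n) C \is a fin_num].
  apply: (@poisson_moment_simple _ _ (maxn m n)) => [i|].
    by apply: simple_on_sub (sf i); apply: cover_ball_nd; exact: leq_maxl.
  by apply: simple_on_sub (st n); apply: cover_ball_nd; exact: leq_maxr.
have [_ fin0 bfin0] : [/\ tilted_moment f (fun=> 0%R) =
      expeR (- Lambda rho (fun=> 0%R)) * moment_sum f (fun=> 0%R) ,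
      tilted_moment f (fun=> 0%R) \is a fin_num &
      forall (C : {set I}) i, i \in C -> block_integral f (fun=> 0%R) C \is a fin_num].
  by apply: (@poisson_moment_simple _ _ m) => //; exact: simple_on0.
have Nt x : random_integral N (t n) x @[n --> \oo] --> random_integral N g x.
  have [] // := @cvg_up_integral _ _ _ (N x) (fun n v => (t n v)%:E) (fun v => (g v)%:E) _ tg.
  by move=> n; exact/measurable_EFinP.
have lim_moment : tilted_moment f (t n) @[n --> \oo] --> tilted_moment f g.
  pose Pi x := \prod_i random_integral N (f i) x.
  have Pi0 x : 0 <= Pi x by apply: prode_ge0 => i _; exact: random_integral_ge0.
  have mPi : measurable_fun setT Pi.
    by apply: emeasurable_prod => i; exact: measurable_random_integral.
  (* Where N(g) is infinite the exponentials tend to 0; finiteness of [Pi x] then excludes [0 * +oo]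
     in the limit. *)
  have Pifin x : Pi x \is a fin_num.
    rewrite /Pi; elim/big_ind: _ => // [u v|i _]; first exact: fin_numM.
    exact: finite_random_integral (sf i).
  have [] // := @dominated_convergence _ _ _ P setT measurableT
    (fun n x => expeR (- random_integral N (t n) x) * Pi x)
    (fun x => expeR (- random_integral N g x) * Pi x) Pi.
  - by move=> n; apply: emeasurable_funM => //; exact: measurable_expeRN_random.
  - by apply: emeasurable_funM => //; exact: measurable_expeRN_random.
  - apply: aeW => x _; apply: cvgeM.
    + apply: mule_def_fin => //.
      have := random_integral_ge0 x g0; by case: (random_integral N g x).
    + apply: cvg_expeRN => //; apply: lt_le_trans (random_integral_ge0 x g0); exact: ltNyr.
    + exact: cvg_cst.
  - apply/integrableP; split => //.
    under eq_integral => x _ do rewrite gee0_abs//.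
    rewrite -ge0_fin_numE; last by apply: integral_ge0.
    move: fin0; congr (_ \is a fin_num); apply: eq_integral => x _.
    by rewrite /random_integral integral0 oppe0 expeR0 mul1e.
  - apply: aeW => x n _.
    rewrite gee0_abs ?mule_ge0 ?expeR_ge0//.
    rewrite -[leRHS]mul1e lee_pmul ?expeR_ge0// -expeR0 lee_expeR leeNl oppe0.
    exact: random_integral_ge0.
have lim_block (C : {set I}) i : i \in C ->
    cvg_fin (fun n => block_integral f (t n) C) (block_integral f g C).
  move=> iC.
  pose B v := (\prod_(i in C) f i v)%R.
  have B0 v : (0 <= B v)%R by apply: prodr_ge0 => j _; exact: f0.
  have mB : measurable_fun [set: borel V] B.
    rewrite /B; under eq_fun do rewrite -big_enum; exact: measurable_prod.
  have mexp (h : V -> R) : measurable_fun [set: borel V] h ->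
      measurable_fun [set: borel V] (fun v => (B v * expR (- h v))%R%:E).
    move=> mh; apply/measurable_EFinP; apply: measurable_funM => //.
    apply: measurableT_comp; first exact: measurable_expR.
    exact: measurableT_comp.
  have Bint : rho.-integrable setT (EFin \o B).
    apply/integrableP; split; first exact/measurable_EFinP.
    under eq_integral => v _ do rewrite gee0_abs ?lee_fin//.
    rewrite -ge0_fin_numE; last by apply: integral_ge0 => v _; rewrite lee_fin.
    move: (bfin0 _ _ iC); congr (_ \is a fin_num); apply: eq_integral => v _.
    by rewrite oppr0 expR0 mulr1.
  have [] // := @dominated_convergence _ _ _ rho setT measurableT
    (fun n v => (B v * expR (- t n v))%R%:E)
    (fun v => (B v * expR (- g v))%R%:E) (EFin \o B).
  - by move=> n; exact: mexp.
  - exact: mexp.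
  - apply: aeW => v _; apply: cvg_EFin; first exact: nearW.
    apply: cvgM; first exact: cvg_cst.
    apply: (@cvg_comp _ _ _ (fun n => - t n v)%R expR); first exact: (cvgN (tgR v)).
    exact: continuous_expR.
  - apply: aeW => v n _; rewrite /= lee_fin normrM !ger0_norm ?expR_ge0//.
    by rewrite ler_piMr// -expR0 ler_expR lerNl oppr0.
  move=> int_g _ lim; split => //.
  exact: (integrable_fin_num measurableT int_g).
have lim_Lambda : cvg_fin (fun n => expeR (- Lambda rho (t n))) (expeR (- Lambda rho g)).
  have [L0 _ Llim] : cvg_up (fun n => Lambda rho (t n)) (Lambda rho g).
    apply: cvg_up_integral => [n|v].
      apply/measurable_EFinP; apply: measurable_funB => //.
      apply: measurableT_comp; first exact: measurable_expR.
      exact: measurableT_comp.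
    case: (tg v) => _ ndt _; split => [n|n k nk|].
    - by rewrite lee_fin subr_ge0 -expR0 ler_expR lerNl oppr0.
    - by rewrite lee_fin lerB// ler_expR lerN2 -lee_fin; exact: ndt.
    - apply: cvg_EFin; first exact: nearW.
      apply: cvgB; first exact: cvg_cst.
      apply: (@cvg_comp _ _ _ (fun n => - t n v)%R expR); first exact: (cvgN (tgR v)).
      exact: continuous_expR.
  have Lg0 : 0 <= Lambda rho g.
    apply: integral_ge0 => v _.
    by rewrite lee_fin subr_ge0 -expR0 ler_expR lerNl oppr0.
  (* The exponential is finite even when [Lambda rho g] is infinite: it is then 0. *)
  split; first by case: (Lambda rho g) Lg0.
  by apply: cvg_expeRN => //; apply: lt_le_trans Lg0; exact: ltNyr.
have lim_sum : cvg_fin (fun n => moment_sum f (t n)) (moment_sum f g).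
  apply: cvg_fin_sum => p pP; apply: cvg_fin_prod => C Cp.
  have [i iC] := partition_block_neq0 pP Cp; exact: lim_block iC.
have [_ lim_rhs] := cvg_finM lim_Lambda lim_sum.
apply: (cvg_unique _ lim_moment) => //.
apply: cvg_trans lim_rhs; apply: near_eq_cvg; near=> n.
by have [-> _ _] := max_ball n.
Unshelve. all: by end_near.
Qed.

(** With [g] fixed, both sides are limits along increasing [f], so the identity survives infinite
    moments. If [Lambda rho g = +oo], the right-hand side is 0 whatever the moment sum, by
    [0 * +oo = 0]. *)
Theorem poisson_moment f g :
  (forall i, measurable_fun [set: borel V] (f i)) -> (forall i v, (0 <= f i v)%R) ->
  measurable_fun [set: borel V] g -> (forall v, (0 <= g v)%R) ->
  tilted_moment f g = expeR (- Lambda rho g) * moment_sum f g.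
Proof.
move=> mf f0 mg g0.
have [s [ss up_s]] := cover_ball_approx mf f0.
have ms m i : measurable_fun [set: borel V] (s m i) by case: (ss m i).
have s0 m i v : (0 <= s m i v)%R by case: (ss m i) => _ _ + _; exact.
have lhs : cvg_up (fun m => tilted_moment (s m) g) (tilted_moment f g).
  apply: cvg_up_integral => [m|x].
    apply: emeasurable_funM; first exact: measurable_expeRN_random.
    by apply: emeasurable_prod => i; exact: measurable_random_integral.
  apply: cvg_upM; first by apply: cvg_up_cst; exact: expeR_ge0.
  apply: cvg_up_prod => i _; apply: cvg_up_integral => [m|v]; last exact: up_s.
  exact/measurable_EFinP.
apply: (cvg_up_unique lhs).
under eq_fun => m do rewrite (poisson_moment_simple_weights (ss m) mg g0).
apply: cvg_upM; first by apply: cvg_up_cst; exact: expeR_ge0.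
apply: cvg_up_sum => p _; apply: cvg_up_prod => C _.
apply: cvg_up_integral => [m|v].
  apply/measurable_EFinP; apply: measurable_funM.
    by under eq_fun do rewrite -big_enum; exact: measurable_prod.
  by apply: measurableT_comp; [exact: measurable_expR|exact: measurableT_comp].
under eq_fun do rewrite EFinM -prodEFin.
rewrite EFinM -prodEFin; apply: cvg_upM.
  by apply: cvg_up_prod => i _; exact: up_s.
by apply: cvg_up_cst; rewrite lee_fin expR_ge0.
Qed.

End poisson_moments.

(** * Tilted intensity, moment measure and likelihood *)

Section density.
Context (R : realType) d (V : measurableType d).
Context (mu : {measure set V -> \bar R}) (e : V -> R).
Context (me : measurable_fun setT e) (e0 : forall v, (0 <= e v)%R).

Definition density_measure (A : set V) : \bar R := \int[mu]_(v in A) (e v)%:E.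

Let density0 : density_measure set0 = 0.
Proof. exact: integral_set0. Qed.

Let density_ge0 A : 0 <= density_measure A.
Proof. by apply: integral_ge0 => v _; rewrite lee_fin. Qed.

Let density_sigma_additive : semi_sigma_additive density_measure.
Proof.
move=> F mF tF mUF; rewrite /density_measure.
rewrite (ge0_integral_bigcup _ mF)//; last 2 first.
- by apply/measurable_EFinP; exact: measurable_funTS.
- by move=> v _; rewrite lee_fin.
apply: is_cvg_ereal_nneg_natsum => n _; exact: density_ge0.
Qed.

HB.instance Definition _ := isMeasure.Build _ _ _ density_measure
  density0 density_ge0 density_sigma_additive.

Lemma density_measure_measure :
  {m : {measure set V -> \bar R} | (m : set V -> \bar R) = density_measure}.
Proof. by exists density_measure. Qed.

(** On indicators this is the definition of the density measure; linearity gives step functions, and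
    increasing limits give [h]. The exhaustion is constantly [setT], as no mass has to be finite
    here. *)
Lemma integral_density (h : V -> R) :
  measurable_fun setT h -> (forall v, (0 <= h v)%R) ->
  \int[density_measure]_v (h v)%:E = \int[mu]_v (h v * e v)%R%:E.
Proof.
move=> mh h0.
have [s [ss sh]] := @simple_on_approx _ _ V (fun=> setT) h
  (fun=> measurableT) (fun _ _ _ _ H => H) (fun v => ex_intro _ 0%N Logic.I) mh h0.
have ms m : measurable_fun setT (s m) by case: (ss m).
have up_l : cvg_up (fun m => \int[density_measure]_v (s m v)%:E)
    (\int[density_measure]_v (h v)%:E).
  by apply: cvg_up_integral => // m; exact/measurable_EFinP.
apply: (cvg_up_unique up_l).
have -> : (fun m => \int[density_measure]_v (s m v)%:E) =
    (fun m => \int[mu]_v ((s m v)%:E * (e v)%:E)).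
  apply/funext => m.
  have [Y [A [a [mA tA _ a0 aE]]]] := simple_on_step measurableT (fun _ : unit => ss m).
  rewrite (aE tt) (integral_step mA)//.
  under [in RHS]eq_integral => v _.
    rewrite -sumEFin ge0_sume_distrl; last by move=> y _; rewrite lee_fin mulr_ge0.
    under eq_bigr do rewrite EFinM -muleA.
    over.
  rewrite ge0_integral_sum//; last 2 first.
  - move=> y; apply: measurable_funeM; apply: emeasurable_funM; exact/measurable_EFinP.
  - by move=> y v _; rewrite !mule_ge0 ?lee_fin.
  apply: eq_bigr => y _; rewrite ge0_integralZl//; last 3 first.
  - apply: emeasurable_funM; exact/measurable_EFinP.
  - by move=> v _; rewrite mule_ge0 ?lee_fin.
  - by rewrite lee_fin.
  congr (_ * _); rewrite /density_measure [LHS]integral_mkcond.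
  apply: eq_integral => v _; rewrite /patch indicE.
  by case: ifP => _; rewrite ?mul1e ?mul0e.
apply: cvg_up_integral => [m|v].
  by apply: emeasurable_funM; exact/measurable_EFinP.
rewrite EFinM; apply: cvg_upM; first exact: sh.
by apply: cvg_up_cst; rewrite lee_fin.
Qed.

End density.

Section power_measure_rectangle.
Context (R : realType) d (T : measurableType d) (mu : {measure set T -> \bar R}).

Lemma power_measure0 n : power_measure mu n (set0 : set (n.-tuple T)) = 0.
Proof.
elim: n => [|n IHn] /=; first exact: measure0.
rewrite -[RHS](@integral0 _ _ _ mu setT); apply: eq_integral => x _.
by rewrite -[RHS]IHn.
Qed.

(** The section of the rectangle at [x] is the rectangle of the remaining sides if [x] is in
    [A ord0], and empty otherwise, so the outer integrand is a constant times an indicator. *)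
Lemma power_measure_rectangle n (A : 'I_n -> set T) :
  (forall i, measurable (A i)) ->
  power_measure mu n [set t : n.-tuple T | forall i, A i (tnth t i)] =
  \prod_(i < n) mu (A i).
Proof.
elim: n => [|n IHn] in A * => mA.
  by rewrite big_ord0 /= diracE mem_set//= => -[].
pose c := power_measure mu n
  [set t : n.-tuple T | forall i, A (lift ord0 i) (tnth t i)].
have cE : c = \prod_(i < n) mu (A (lift ord0 i)).
  exact: (IHn (fun i => A (lift ord0 i))).
have c0 : 0 <= c by rewrite cE prode_ge0.
rewrite big_ord_recl -cE.
rewrite -[X in mu X]setIT -integral_indic// -ge0_integralZr//; last exact/measurable_EFinP.
rewrite /=; apply: eq_integral => x _; rewrite indicE.
have [xA|xA] := boolP (x \in A ord0).
  rewrite mul1e /c; congr power_measure; apply/seteqP; split => t /= tA i.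
    by have := tA (lift ord0 i); rewrite tnthS.
  have [j ->|->] := unliftP ord0 i; first by rewrite tnthS.
  by move: xA; rewrite inE tnth0.
rewrite mul0e -(power_measure0 n); congr power_measure.
apply/seteqP; split => t //= /(_ ord0); rewrite tnth0 => xA'.
by move: xA; rewrite mem_set.
Qed.

End power_measure_rectangle.

Section moment_measure.
Context (R : realType) (V : completeMetricType R) (rho : set V -> \bar R).
Context d (T : measurableType d) (P : probability T R).
Context (N : R.-ker T ~> borel V) (hN : poisson_random_measure P rho N).
Context (n : nat) (M : {measure set (n.-tuple (borel V)) -> \bar R}).
Context (hM : forall A : set (n.-tuple (borel V)), measurable A ->
  M A = \int[P]_x power_measure (N x) n A).

(** A product of step functions in separate variables is a finite combination of indicators of
    rectangles, one for each choice [c] of a cell per coordinate; on these [hM] turns [M] into the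
    mean of a product of the [N x (A (c i))]. *)
Lemma moment_integral_simple (f : 'I_n -> V -> R) m :
  (forall i, simple_on (cover_ball m : set (borel V)) (f i)) ->
  moment_integral f M = \int[P]_x \prod_(i < n) random_integral N (f i) x.
Proof.
move=> sf.
have [Y [A [a [mA tA AD a0 aE]]]] := @simple_on_step _ _ (borel V) (cover_ball m)
  'I_n f (measurable_cover_ball m) sf.
have NA x y : N x (A y) \is a fin_num.
  rewrite ge0_fin_numE//.
  apply: le_lt_trans (cover_ball_fin m (prm_boundedly_finite hN x)).
  by apply: le_measure; rewrite ?inE//; exact: measurable_cover_ball.
pose rect (c : {ffun 'I_n -> Y}) : set (n.-tuple (borel V)) :=
  [set t | forall i, A (c i) (tnth t i)].
have mrect c : measurable (rect c).
  apply: (measurable_forall (E := fun i => [set t : n.-tuple (borel V) | A (c i) (tnth t i)])) => i.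
  by rewrite -[X in measurable X]setTI; exact: (measurable_tnth i measurableT (mA (c i))).
pose w (c : {ffun 'I_n -> Y}) : R := (\prod_i a i (c i))%R.
have w0 c : (0 <= w c)%R by apply: prodr_ge0.
transitivity (\int[M]_t \sum_c (w c)%:E * (\1_(rect c) t)%:E).
  apply: eq_integral => t _; under [RHS]eq_bigr do rewrite -EFinM.
  rewrite sumEFin; congr EFin.
  rewrite (eq_bigr (fun i => \sum_y a i y * \1_(A y) (tnth t i))%R); last first.
    by move=> i _; rewrite (aE i).
  rewrite bigA_distr_bigA /=; apply: eq_bigr => c _.
  rewrite big_split /=; congr (_ * _)%R.
  rewrite indicE; have [ct|/negP ct] := boolP (t \in rect c).
    apply: big1 => i _; rewrite indicE mem_set//.
    by move: ct; rewrite inE; exact.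
  have [i it] : exists i, ~ A (c i) (tnth t i).
    by apply/existsNP => H; apply: ct; rewrite inE.
  by rewrite (bigD1 i)//= indicE memNset// mul0r.
rewrite ge0_integral_sum//; last 2 first.
- by move=> c; apply: measurable_funeM; apply/measurable_EFinP.
- by move=> c t _; rewrite mule_ge0 ?lee_fin.
transitivity (\sum_c (w c)%:E * \int[P]_x \prod_i N x (A (c i))).
  apply: eq_bigr => c _; rewrite ge0_integralZl//; last 2 first.
  - exact/measurable_EFinP.
  - by rewrite lee_fin.
  rewrite integral_indic// setIT; congr (_ * _); rewrite hM//.
  apply: eq_integral => x _.
  exact: (power_measure_rectangle _ (fun i => mA (c i))).
transitivity (\int[P]_x \sum_c (w c)%:E * \prod_i N x (A (c i))).
  rewrite ge0_integral_sum//; last 2 first.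
  - move=> c; apply: measurable_funeM.
    by apply: emeasurable_prod => i; exact: measurable_kernel.
  - by move=> c x _; rewrite mule_ge0 ?lee_fin// prode_ge0.
  apply: eq_bigr => c _; rewrite ge0_integralZl//; last 3 first.
  - by apply: emeasurable_prod => i; exact: measurable_kernel.
  - by move=> x _; rewrite prode_ge0.
  - by rewrite lee_fin.
apply: eq_integral => x _.
rewrite [RHS](eq_bigr (fun i => (\sum_y a i y * fine (N x (A y)))%R%:E)); last first.
  move=> i _; rewrite /random_integral (aE i) (integral_step mA)// -sumEFin.
  by apply: eq_bigr => y _; rewrite EFinM fineK.
rewrite prodEFin bigA_distr_bigA -sumEFin /=; apply: eq_bigr => c _.
rewrite big_split /= EFinM; congr (_ * _).
by rewrite -prodEFin; apply: eq_bigr => i _; rewrite fineK.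
Qed.

Lemma moment_integralE (f : 'I_n -> V -> R) :
  (forall i, measurable_fun [set: borel V] (f i)) -> (forall i v, (0 <= f i v)%R) ->
  moment_integral f M = \int[P]_x \prod_(i < n) random_integral N (f i) x.
Proof.
move=> mf f0.
have [s [ss up_s]] := cover_ball_approx mf f0.
have ms m i : measurable_fun [set: borel V] (s m i) by case: (ss m i).
have s0 m i v : (0 <= s m i v)%R by case: (ss m i) => _ _ + _; exact.
have lhs : cvg_up (fun m => moment_integral (s m) M) (moment_integral f M).
  apply: cvg_up_integral => [m|t].
    apply/measurable_EFinP; apply: measurable_prod => i _.
    exact: measurableT_comp (ms m i) (measurable_tnth i).
  under eq_fun do rewrite -prodEFin.
  by rewrite -prodEFin; apply: cvg_up_prod => i _; exact: up_s.
apply: (cvg_up_unique lhs).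
under eq_fun => m do rewrite (moment_integral_simple (ss m)).
apply: cvg_up_integral => [m|x].
  by apply: emeasurable_prod => i; exact: measurable_random_integral.
apply: cvg_up_prod => i _; apply: cvg_up_integral => [m|v]; last exact: up_s.
exact/measurable_EFinP.
Qed.

End moment_measure.

Section tilted_intensity.
Context (R : realType) (V : completeMetricType R).
Context (nu : {measure set (borel V) -> \bar R}) (n : nat) (f : 'I_n -> V -> R).
Context (mf : forall i, measurable_fun [set: borel V] (f i)).
Context (f0 : forall i v, (0 <= f i v)%R).
Context (w : n.-tuple R) (w0 : forall i, (0 <= tnth w i)%R).

Lemma measurable_Omega : measurable_fun [set: borel V] (Omega f w).
Proof. by apply: measurable_sum => i; exact: measurable_funM. Qed.

Lemma Omega_ge0 v : (0 <= Omega f w v)%R.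
Proof. by apply: sumr_ge0 => i _; rewrite mulr_ge0. Qed.

Let mexp : measurable_fun [set: borel V] (fun v => expR (- Omega f w v)).
Proof.
apply: measurableT_comp; first exact: measurable_expR.
by apply: measurableT_comp => //; exact: measurable_Omega.
Qed.

Let mprod (C : {set 'I_n}) : measurable_fun [set: borel V] (fun v => \prod_(i in C) f i v)%R.
Proof. by under eq_fun do rewrite -big_enum; exact: measurable_prod. Qed.

Lemma partition_sumE : partition_sum nu f w = moment_sum nu f (Omega f w).
Proof.
apply: eq_bigr => p _; apply: eq_bigr => C _.
apply: (integral_density nu mexp (fun v => expR_ge0 _) (mprod C)).
by move=> v; apply: prodr_ge0.
Qed.

Lemma moment_integral_partition (M : {measure set (n.-tuple (borel V)) -> \bar R}) :
  boundedly_finite nu -> poisson_moment_measure (tilted nu f w) M ->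
  moment_integral f M = partition_sum nu f w.
Proof.
move=> hnu [d [T [P [N [hN hM]]]]].
have [m mE] := density_measure_measure nu mexp (fun v => expR_ge0 _).
have tiltedE : (m : set (borel V) -> \bar R) = tilted nu f w by [].
(* [Omega] is nonnegative, so the density is at most 1 and the tilted intensity is bounded by
   [nu]. *)
have hm : boundedly_finite m.
  move=> A mA Ab; apply: le_lt_trans (hnu _ mA Ab).
  rewrite tiltedE /tilted -[leRHS]mul1e -integral_cst//; apply: ge0_le_integral => //.
  - by apply/measurable_EFinP; exact: measurable_funTS.
  - by move=> v _; rewrite lee_fin -expR0 ler_expR lerNl oppr0 Omega_ge0.
rewrite (moment_integralE hN hM mf f0).
rewrite -tiltedE in hN.
(* The tilt now sits in the intensity [m] instead of in the integrand, so [g = 0] and every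
   exponential factor equals 1. *)
have := poisson_moment hm hN mf f0 (g := fun=> 0%R) (@measurable_cst _ _ _ _ _ _) (fun=> lexx _).
have -> : Lambda m (fun=> 0%R) = 0.
  rewrite /Lambda -[RHS](@integral0 _ _ _ m setT); apply: eq_integral => v _.
  by rewrite oppr0 expR0 subrr.
rewrite oppe0 expeR0 mul1e /tilted_moment.
under eq_integral => x _ do rewrite /random_integral integral0 oppe0 expeR0 mul1e.
move=> ->; apply: eq_bigr => p _; apply: eq_bigr => C _.
rewrite /block_integral -tiltedE; apply: eq_integral => v _.
by rewrite oppr0 expR0 mulr1.
Qed.

(** The exponents add up to N(Omega) by linearity of the integral on nonnegative functions, which
    also covers infinite N(f_i). *)
Lemma likelihood_integrand d (T : measurableType d) (P : probability T R)
    (N : R.-ker T ~> borel V) :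
  boundedly_finite nu -> poisson_random_measure P nu N ->
  \int[P]_x \prod_(i < n) (expeR (- ((tnth w i)%:E * random_integral N (f i) x)) *
       random_integral N (f i) x) =
  partition_sum nu f w * expeR (- Lambda nu (Omega f w)).
Proof.
move=> hnu hN.
rewrite partition_sumE muleC.
rewrite -(poisson_moment hnu hN mf f0 measurable_Omega Omega_ge0).
apply: eq_integral => x _; rewrite big_split /=; congr (_ * _).
rewrite -expeRN_sum; last first.
  by move=> i; rewrite mule_ge0 ?lee_fin// random_integral_ge0.
congr (expeR (- _)); rewrite /random_integral /Omega.
under [RHS]eq_integral do rewrite -sumEFin.
rewrite ge0_integral_sum//; last 2 first.
- by move=> i; apply/measurable_EFinP; exact: measurable_funM.
- by move=> i v _; rewrite lee_fin mulr_ge0.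
apply: eq_bigr => i _; under [RHS]eq_integral do rewrite EFinM.
rewrite ge0_integralZl//; first exact/measurable_EFinP.
- by move=> v _; rewrite lee_fin.
- by rewrite lee_fin.
Qed.

End tilted_intensity.

(** The integral sees only the restriction of the integrand to the positive orthant, for any set
    function such as [power_measure]. *)
Lemma eq_integral_Rplus (R : realType) (n : nat) (F G : n.-tuple R -> \bar R) :
  (forall w : n.-tuple R, (forall i, (0 <= tnth w i)%R) -> F w = G w) ->
  integral_Rplus F = integral_Rplus G.
Proof.
move=> FG; rewrite /integral_Rplus /integral.
set D := [set w : n.-tuple R | _].
have -> // : F \_ D = G \_ D.
apply/funext => w; rewrite /patch; case: ifPn => //; rewrite inE => wD.
by apply: FG => i; exact: ltW (wD i).
Qed.

Theorem theorem3p1 (R : realType) (V : completeMetricType R)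
    (hV : separable V)
    (nu : {measure set (borel V) -> \bar R}) (hnu : boundedly_finite nu)
    (d : measure_display) (T : measurableType d) (P : probability T R)
    (N : R.-ker T ~> borel V) (hN : poisson_random_measure P nu N)
    (n : nat) (hn : (0 < n)%N) (f : 'I_n -> V -> R)
    (mf : forall i, measurable_fun [set: borel V] (f i))
    (f0 : forall i v, (0 <= f i v)%R)
    (hLambda : forall w : n.-tuple R, (forall i, (0 <= tnth w i)%R) ->
      Lambda nu (Omega f w) < +oo)
    (Delta mu beta : R) (hDelta : (0 < Delta)%R) (X : n.-tuple R) :
  likelihood f P N Delta mu beta X =
    integral_Rplus (fun w => partition_sum nu f w *
      expeR (- Lambda nu (Omega f w)) *
      (observation_density Delta mu beta X w)%:E)
  /\
  forall M : n.-tuple R -> {measure set (n.-tuple (borel V)) -> \bar R},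
    (forall w : n.-tuple R, (forall i, (0 <= tnth w i)%R) ->
      poisson_moment_measure (tilted nu f w) (M w)) ->
    (forall w : n.-tuple R, (forall i, (0 <= tnth w i)%R) ->
      moment_integral f (M w) = partition_sum nu f w) /\
    likelihood f P N Delta mu beta X =
      integral_Rplus (fun w => moment_integral f (M w) *
        expeR (- Lambda nu (Omega f w)) *
        (observation_density Delta mu beta X w)%:E).
Proof.
have likelihoodE : likelihood f P N Delta mu beta X =
    integral_Rplus (fun w => partition_sum nu f w *
      expeR (- Lambda nu (Omega f w)) *
      (observation_density Delta mu beta X w)%:E).
  apply: eq_integral_Rplus => w w0.
  by rewrite (likelihood_integrand mf f0 w0 hnu hN) muleC.
split=> // M hM.
have momentE (w : n.-tuple R) : (forall i, (0 <= tnth w i)%R) ->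
    moment_integral f (M w) = partition_sum nu f w.
  by move=> w0; exact: (moment_integral_partition mf f0 w0 hnu (hM w w0)).
split=> //; rewrite likelihoodE; apply: eq_integral_Rplus => w w0.
by rewrite momentE.
Qed.
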